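(* Let $\mathbb{F}$ be a field of characteristic not $2$ or $3$ and let $\eta\in\mathbb{F}\setminus\{1,\frac12\}$. If $\eta=-1$, choose arbitrary $\alpha,\beta,\gamma,\psi\in\mathbb{F}$; if $\eta\neq-1$, set $\alpha=\beta=\gamma=\psi=1$. Let $V$ be an $8$-dimensional $\mathbb{F}$-vector space with basis $e_1,\dots,e_8$, denoted also $e_1=a$, $e_2=b$, $e_3=c$, $e_4=p$, $e_5=q$, $e_6=r$, $e_7=s$, $e_8=t$, and define a commutative bilinear product on $V$ by the list $L(-1)$ in the context if $\eta=-1$, and by the list $L(\eta)$ in the context if $\eta\neq-1$. Then $V$ with this product is a $\mathcal{PC}(\eta)$-axial algebra generated by the three primitive axes $e_1,e_2,e_3$. Moreover, suppose that $A$ is a $\mathcal{PC}(\eta)$-axial algebra over $\mathbb{F}$ generated by three primitive axes $x,y,z$ and endowed with the Frobenius form $(\cdot,\cdot)$ satisfying $(u,u)=1$ for all primitive axes $u\in A$. If $(x,y)=\alpha$, $(y,z)=\beta$, $(x,z)=\gamma$, and $(x,yz)=\psi$, then $A$ is a homomorphic image of $V$.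
   Context: Algebras are not assumed associative or unital. For a commutative $\mathbb{F}$-algebra $A$, $a\in A$ and $\lambda\in\mathbb{F}$, put $A_\lambda(a)=\{u\in A\mid au=\lambda u\}$. A ($\mathcal{PC}(\eta)$-)axis in $A$ is an idempotent $a\in A$ such that $A=A_1(a)\oplus A_\eta(a)\oplus A_{1/2}(a)$ and the fusion law $\mathcal{PC}(\eta)$ holds: $A_1(a)A_1(a)\subseteq A_1(a)$, $A_1(a)A_\eta(a)\subseteq A_\eta(a)$, $A_1(a)A_{1/2}(a)\subseteq A_{1/2}(a)$, $A_\eta(a)A_\eta(a)\subseteq A_1(a)$, $A_\eta(a)A_{1/2}(a)\subseteq A_{1/2}(a)$, $A_{1/2}(a)A_{1/2}(a)\subseteq A_1(a)\oplus A_\eta(a)$. An axis $a$ is primitive if $A_1(a)=\langle a\rangle$ is $1$-dimensional. A $\mathcal{PC}(\eta)$-axial algebra is a commutative $\mathbb{F}$-algebra generated by a set of axes. A Frobenius form is a non-zero symmetric bilinear form with $(xy,z)=(x,yz)$ for all $x,y,z$; an algebra generated by primitive $\mathcal{PC}(\eta)$-axes has exactly one Frobenius form with $(x,x)=1$ for all primitive axes $x$. **List $L(-1)$** (depending on $\alpha,\beta,\gamma,\psi$; products are commutative): $a^2=a$, $b^2=b$, $c^2=c$, $ab=p$, $ac=r$, $bc=q$, $aq=s$, $br=t$, $cp=\beta a+\gamma b+\alpha c-s-t$; $ap=\alpha a+\frac12b-\frac12p$, $ar=\gamma a+\frac12c-\frac12r$, $bp=\alpha b+\frac12a-\frac12p$,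 $bq=\beta b+\frac12c-\frac12q$, $cr=\gamma c+\frac12a-\frac12r$, $cq=\beta c+\frac12b-\frac12q$; $as=\psi a+\frac12q-\frac12s$, $bt=\psi b+\frac12r-\frac12t$; $bs=\frac14(\beta a+(\gamma-2\psi)b-3\alpha c-2\beta p+6\alpha q-r+2s+2t)$; $cs=\frac14(3\beta a-\gamma b+(3\alpha-2\psi)c-p+6\gamma q-2\beta r-2t)$; $at=\frac14((\beta-2\psi)a+\gamma b-3\alpha c-2\gamma p-q+6\alpha r+2s+2t)$; $ct=\frac14(-\beta a+3\gamma b+(3\alpha-2\psi)c-p-2\gamma q+6\beta r-2s)$; $p^2=\frac14((6\alpha-1)(a+b)-(4\alpha+2)p)$, $q^2=\frac14((6\beta-1)(b+c)-(4\beta+2)q)$, $r^2=\frac14((6\gamma-1)(a+c)-(4\gamma+2)r)$; $pq=\frac14(3\beta a+(6\psi-\gamma)b+3\alpha c-2\beta p-2\alpha q-r-2t)$; $qr=\frac14(\beta a+\gamma b+(6\psi-3\alpha)c-p-2\gamma q-2\beta r+2s+2t)$; $pr=\frac14((6\psi-\beta)a+3\gamma b+3\alpha c-2\gamma p-q-2\alpha r-2s)$; $ps=\frac18((12\alpha\beta-2\beta+6\gamma-6\psi)a+(6\psi-2\beta)b-c-4(\beta+\psi)p+(6\alpha+1)q-2r+(2-4\alpha)s)$; $pt=\frac18((6\psi-2\gamma)a+(12\alpha\gamma+6\beta-2\gamma-6\psi)b-c-4(\gamma+\psi)p-2q+(6\alpha+1)r+(2-4\alpha)t)$; $qs=\frac18((4\beta^2-2\beta+2)a+(1-6\beta)p+8\psi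 q+(1-6\beta)r+(4\beta+2)s)$; $qt=\frac18(-a+(12\beta\gamma+6\alpha-2\gamma-6\psi)b+(6\psi-2\gamma)c-2p-4(\gamma+\psi)q+(6\beta+1)r+(2-4\beta)t)$; $rs=\frac18((12\beta\gamma+6\alpha-2\beta-6\psi)a-b+(6\psi-2\beta)c-2p+(6\gamma+1)q-4(\beta+\psi)r+(2-4\gamma)s)$; $rt=\frac18((4\gamma^2-2\gamma+2)b+(1-6\gamma)p+(1-6\gamma)q+8\psi r+(4\gamma+2)t)$; $s^2=\frac1{16}((36\alpha\beta-4\beta^2+36\beta\gamma-24\beta\psi-6\alpha+2\beta-6\gamma-12\psi-2)a+(1-6\beta)(b+c)+2(1-6\beta)(p+r)+(4\beta+24\psi+2)q+(8\beta-16\psi+4)s)$; $t^2=\frac1{16}((1-6\gamma)(a+c)+(36\alpha\gamma+36\beta\gamma-4\gamma^2-24\gamma\psi-6\alpha-6\beta+2\gamma-12\psi-2)b+(2-12\gamma)(p+q)+(4\gamma+24\psi+2)r+(8\gamma-16\psi+4)t)$; $st=\frac1{16}((12\beta\psi-6\alpha\beta-2\beta^2-14\beta\gamma+\beta+6\gamma+6\psi+1)a+(12\gamma\psi-6\alpha\gamma-14\beta\gamma-2\gamma^2+6\beta+\gamma+6\psi+1)b+(18\alpha^2+6\alpha\beta+6\alpha\gamma-36\alpha\psi+3\alpha-6\psi-2)c+(6\gamma-6\alpha+6\beta-32\beta\gamma+12\psi-1)p+(24\alpha\gamma-6\alpha+2\beta+6\gamma-12\psi-1)q+(24\alpha\beta-6\alpha+6\beta+2\gamma-12\psi-1)r+(8\gamma-12\alpha-4\beta+16\psi-4)s+(8\beta-12\alpha-4\gamma+16\psi-4)t)$.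 **List $L(\eta)$, $\eta\neq-1$** (products are commutative): $a^2=a$, $b^2=b$, $c^2=c$, $ab=p$, $ac=r$, $bc=q$, $aq=s$, $br=t$, $cp=(\eta+1)(p+q+r)-\eta(a+b+c)-s-t$; $ap=\frac12((1-\eta)a-\eta b+(1+2\eta)p)$, $ar=\frac12((1-\eta)a-\eta c+(1+2\eta)r)$, $bp=\frac12((1-\eta)b-\eta a+(1+2\eta)p)$, $bq=\frac12((1-\eta)b-\eta c+(1+2\eta)q)$, $cr=\frac12((1-\eta)c-\eta a+(1+2\eta)r)$, $cq=\frac12((1-\eta)c-\eta b+(1+2\eta)q)$; $as=\frac12((1-\eta)a-\eta q+(1+2\eta)s)$, $bt=\frac12((1-\eta)b-\eta r+(1+2\eta)t)$; $bs=\frac14(-\eta a+(1-2\eta^2)b+(\eta-2\eta^2)c+2\eta p+(4\eta^2-2\eta)q-r+2s+2t)$; $cs=\frac14(-3\eta a-(2\eta^2+2\eta-1)c+(2\eta+1)(p+2r-\eta b)+(4\eta^2+2)q-2t)$; $at=\frac14((1-2\eta^2)a-\eta b+(\eta-2\eta^2)c+2\eta p-q+(4\eta^2-2\eta)r+2s+2t)$; $ct=\frac14(-3\eta b-(2\eta^2+2\eta-1)c+(2\eta+1)(p+2q-\eta a)+(4\eta^2+2)r-2s)$; $p^2=\frac14((1-4\eta)(a+b)+(8\eta+2)p)$, $q^2=\frac14((1-4\eta)(b+c)+(8\eta+2)q)$, $r^2=\frac14((1-4\eta)(a+c)+(8\eta+2)r)$; $pq=\frac14(-3\eta(a+c)+(1-4\eta)b+(2\eta+1)(2p+2q+r)-2t)$;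 $pr=\frac14((1-4\eta)a-3\eta(b+c)+(2\eta+1)(2p+q+2r)-2s)$; $qr=\frac14(-\eta(a+b)+(1-2\eta)c-p+2\eta(q+r)+2s+2t)$; $ps=\frac18((2-8\eta)a-(2\eta^2+5\eta-1)b-(2\eta^2+\eta)c+(10\eta+2)p+(4\eta^2-2\eta+1)q+2\eta r+(4\eta+2)s)$; $qs=\frac18(-4\eta a-(4\eta^2+3\eta-1)(b+c)+(4\eta-1)(p+r)+(8\eta^2+2\eta+2)q+6s)$; $rs=\frac18((2-8\eta)a-(2\eta^2+\eta)b-(2\eta^2+5\eta-1)c+2\eta p+(4\eta^2-2\eta+1)q+(10\eta+2)r+(4\eta+2)s)$; $pt=\frac18((1-5\eta-2\eta^2)a+(2-8\eta)b-(2\eta^2+\eta)c+(10\eta+2)p+2\eta q+(4\eta^2-2\eta+1)r+(4\eta+2)t)$; $qt=\frac18(-(2\eta^2+\eta)a+(2-8\eta)b+(1-5\eta-2\eta^2)c+2\eta p+(10\eta+2)q+(4\eta^2-2\eta+1)r+(4\eta+2)t)$; $rt=\frac18((1-3\eta-4\eta^2)(a+c)-4\eta b+(4\eta-1)(p+q)+(8\eta^2+2\eta+2)r+6t)$; $s^2=\frac1{16}((4-16\eta)a+(1-2\eta-8\eta^2)(b+c)+(8\eta-2)(p+r+(2\eta-1)q)+(16\eta+12)s)$; $t^2=\frac1{16}((1-2\eta-8\eta^2)(a+c)+(4-16\eta)b+(8\eta-2)(p+q+(2\eta-1)r)+(16\eta+12)t)$; $st=\frac1{16}((2-8\eta-6\eta^2)(a+b)+(1-12\eta^2)c+(12\eta-3)p+(12\eta^2-2\eta-1)(q+r)+(4\eta+8)(s+t))$.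 *)

(* Defs.v *)
From mathcomp Require Import all_boot all_order all_algebra.

Set Implicit Arguments.
Unset Strict Implicit.
Unset Printing Implicit Defensive.

Import GRing.Theory.
Local Open Scope ring_scope.

(* An algebra is an F-module A, of any dimension, with a product mul that need
   be neither associative nor unital; subspaces and subsets of A are
   predicates A -> Prop. *)
Section CommutativeAlgebras.

Variables (F : fieldType) (A : lmodType F) (mul : A -> A -> A).

Record is_comm_algebra : Prop := IsCommAlgebra {
  comm_algebraC : commutative mul;
  comm_algebra_linearl : forall v : A, linear (mul^~ v);
  comm_algebra_linearr : forall u : A, linear (mul u)
}.

Record is_subalgebra (S : A -> Prop) : Prop := IsSubalgebra {
  subalgebra0 : S 0;
  subalgebra_linear : forall (k : F) (u v : A), S u -> S v -> S (k *: u + v);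
  subalgebra_mul : forall u v : A, S u -> S v -> S (mul u v)
}.

Definition generates (X : A -> Prop) : Prop :=
  forall S : A -> Prop, is_subalgebra S -> (forall u, X u -> S u) ->
    forall u, S u.

Definition eigensp (lam : F) (a : A) : A -> Prop := fun u => mul a u = lam *: u.

Definition add_sp (U W : A -> Prop) : A -> Prop :=
  fun v => exists u w, [/\ U u, W w & v = u + w].

Definition direct_sum3 (U1 U2 U3 : A -> Prop) : Prop :=
  (forall v, exists u1 u2 u3, [/\ U1 u1, U2 u2, U3 u3 & v = u1 + u2 + u3]) /\
  (forall u1 u2 u3, U1 u1 -> U2 u2 -> U3 u3 -> u1 + u2 + u3 = 0 ->
     [/\ u1 = 0, u2 = 0 & u3 = 0]).

Definition mul_sub (U W Z : A -> Prop) : Prop :=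
  forall u w, U u -> W w -> Z (mul u w).

Variable eta : F.

Record PC_fusion (a : A) : Prop := PCFusion {
  fusion_1_1 : mul_sub (eigensp 1 a) (eigensp 1 a) (eigensp 1 a);
  fusion_1_eta : mul_sub (eigensp 1 a) (eigensp eta a) (eigensp eta a);
  fusion_1_half : mul_sub (eigensp 1 a) (eigensp 2^-1 a) (eigensp 2^-1 a);
  fusion_eta_eta : mul_sub (eigensp eta a) (eigensp eta a) (eigensp 1 a);
  fusion_eta_half : mul_sub (eigensp eta a) (eigensp 2^-1 a) (eigensp 2^-1 a);
  fusion_half_half : mul_sub (eigensp 2^-1 a) (eigensp 2^-1 a)
                       (add_sp (eigensp 1 a) (eigensp eta a))
}.

Record is_axis (a : A) : Prop := IsAxis {
  axis_idem : mul a a = a;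
  axis_decomp : direct_sum3 (eigensp 1 a) (eigensp eta a) (eigensp 2^-1 a);
  axis_fusion : PC_fusion a
}.

(* The condition a != 0 expresses that the line <a> is 1-dimensional. *)
Record is_primitive_axis (a : A) : Prop := IsPrimitiveAxis {
  primitive_axis_axis : is_axis a;
  primitive_axis_neq0 : a != 0;
  primitive_axis_line : forall u, eigensp 1 a u <-> exists k : F, u = k *: a
}.

Definition PC_axial_algebra : Prop :=
  is_comm_algebra /\
  exists X : A -> Prop, (forall u, X u -> is_axis u) /\ generates X.

Record PC_axial_algebra_gen3 (x y z : A) : Prop := PCAxialAlgebraGen3 {
  gen3_axial : PC_axial_algebra;
  gen3_primitive1 : is_primitive_axis x;
  gen3_primitive2 : is_primitive_axis y;
  gen3_primitive3 : is_primitive_axis z;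
  gen3_generates : generates (fun u => [\/ u = x, u = y | u = z])
}.

Record is_Frobenius_form (form : A -> A -> F) : Prop := IsFrobeniusForm {
  Frobenius_linearl : forall v : A, scalar (form^~ v);
  Frobenius_linearr : forall u : A, scalar (form u);
  Frobenius_sym : forall u v, form u v = form v u;
  Frobenius_assoc : forall u v w, form (mul u v) w = form u (mul v w);
  Frobenius_neq0 : exists u v, form u v != 0
}.

End CommutativeAlgebras.

Definition homomorphic_image (F : fieldType) (A B : lmodType F)
    (mulA : A -> A -> A) (mulB : B -> B -> B) : Prop :=
  exists f : {linear A -> B},
    (forall u v, f (mulA u v) = mulB (f u) (f v)) /\
    (forall w, exists u, f u = w).

(* Names for the elements a, b, c, p, q, r, s, t of the basis. *)
Inductive letter := Ia | Ib | Ic | Ip | Iq | Ir | Is | It.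

Definition letters : seq letter := [:: Ia; Ib; Ic; Ip; Iq; Ir; Is; It].

Section Tables.

Variables (F : fieldType) (V : lmodType F) (a b c p q r s t : V).

Definition table_m1 (alpha beta gamma psi : F) (i j : letter) : V :=
  match i, j with
  | Ia, Ia => a
  | Ib, Ib => b
  | Ic, Ic => c
  | Ia, Ib | Ib, Ia => p
  | Ia, Ic | Ic, Ia => r
  | Ib, Ic | Ic, Ib => q
  | Ia, Iq | Iq, Ia => s
  | Ib, Ir | Ir, Ib => t
  | Ic, Ip | Ip, Ic => beta *: a + gamma *: b + alpha *: c - s - t
  | Ia, Ip | Ip, Ia => alpha *: a + 2^-1 *: b - 2^-1 *: p
  | Ia, Ir | Ir, Ia => gamma *: a + 2^-1 *: c - 2^-1 *: r
  | Ib, Ip | Ip, Ib => alpha *: b + 2^-1 *: a - 2^-1 *: p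
  | Ib, Iq | Iq, Ib => beta *: b + 2^-1 *: c - 2^-1 *: q
  | Ic, Ir | Ir, Ic => gamma *: c + 2^-1 *: a - 2^-1 *: r
  | Ic, Iq | Iq, Ic => beta *: c + 2^-1 *: b - 2^-1 *: q
  | Ia, Is | Is, Ia => psi *: a + 2^-1 *: q - 2^-1 *: s
  | Ib, It | It, Ib => psi *: b + 2^-1 *: r - 2^-1 *: t
  | Ib, Is | Is, Ib =>
      4^-1 *: (beta *: a + (gamma - 2 * psi) *: b - (3 * alpha) *: c
        - (2 * beta) *: p + (6 * alpha) *: q - r + 2 *: s + 2 *: t)
  | Ic, Is | Is, Ic =>
      4^-1 *: ((3 * beta) *: a - gamma *: b + (3 * alpha - 2 * psi) *: c
        - p + (6 * gamma) *: q - (2 * beta) *: r - 2 *: t)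
  | Ia, It | It, Ia =>
      4^-1 *: ((beta - 2 * psi) *: a + gamma *: b - (3 * alpha) *: c
        - (2 * gamma) *: p - q + (6 * alpha) *: r + 2 *: s + 2 *: t)
  | Ic, It | It, Ic =>
      4^-1 *: (- beta *: a + (3 * gamma) *: b + (3 * alpha - 2 * psi) *: c
        - p - (2 * gamma) *: q + (6 * beta) *: r - 2 *: s)
  | Ip, Ip =>
      4^-1 *: ((6 * alpha - 1) *: (a + b) - (4 * alpha + 2) *: p)
  | Iq, Iq =>
      4^-1 *: ((6 * beta - 1) *: (b + c) - (4 * beta + 2) *: q)
  | Ir, Ir =>
      4^-1 *: ((6 * gamma - 1) *: (a + c) - (4 * gamma + 2) *: r)
  | Ip, Iq | Iq, Ip =>
      4^-1 *: ((3 * beta) *: a + (6 * psi - gamma) *: b + (3 * alpha) *: c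
        - (2 * beta) *: p - (2 * alpha) *: q - r - 2 *: t)
  | Iq, Ir | Ir, Iq =>
      4^-1 *: (beta *: a + gamma *: b + (6 * psi - 3 * alpha) *: c
        - p - (2 * gamma) *: q - (2 * beta) *: r + 2 *: s + 2 *: t)
  | Ip, Ir | Ir, Ip =>
      4^-1 *: ((6 * psi - beta) *: a + (3 * gamma) *: b + (3 * alpha) *: c
        - (2 * gamma) *: p - q - (2 * alpha) *: r - 2 *: s)
  | Ip, Is | Is, Ip =>
      8^-1 *: ((12 * alpha * beta - 2 * beta + 6 * gamma - 6 * psi) *: a
        + (6 * psi - 2 * beta) *: b - c - (4 * (beta + psi)) *: p
        + (6 * alpha + 1) *: q - 2 *: r + (2 - 4 * alpha) *: s)
  | Ip, It | It, Ip =>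
      8^-1 *: ((6 * psi - 2 * gamma) *: a
        + (12 * alpha * gamma + 6 * beta - 2 * gamma - 6 * psi) *: b - c
        - (4 * (gamma + psi)) *: p - 2 *: q + (6 * alpha + 1) *: r
        + (2 - 4 * alpha) *: t)
  | Iq, Is | Is, Iq =>
      8^-1 *: ((4 * beta ^+ 2 - 2 * beta + 2) *: a + (1 - 6 * beta) *: p
        + (8 * psi) *: q + (1 - 6 * beta) *: r + (4 * beta + 2) *: s)
  | Iq, It | It, Iq =>
      8^-1 *: (- a + (12 * beta * gamma + 6 * alpha - 2 * gamma - 6 * psi) *: b
        + (6 * psi - 2 * gamma) *: c - 2 *: p - (4 * (gamma + psi)) *: q
        + (6 * beta + 1) *: r + (2 - 4 * beta) *: t)
  | Ir, Is | Is, Ir =>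
      8^-1 *: ((12 * beta * gamma + 6 * alpha - 2 * beta - 6 * psi) *: a - b
        + (6 * psi - 2 * beta) *: c - 2 *: p + (6 * gamma + 1) *: q
        - (4 * (beta + psi)) *: r + (2 - 4 * gamma) *: s)
  | Ir, It | It, Ir =>
      8^-1 *: ((4 * gamma ^+ 2 - 2 * gamma + 2) *: b + (1 - 6 * gamma) *: p
        + (1 - 6 * gamma) *: q + (8 * psi) *: r + (4 * gamma + 2) *: t)
  | Is, Is =>
      16^-1 *: ((36 * alpha * beta - 4 * beta ^+ 2 + 36 * beta * gamma
          - 24 * beta * psi - 6 * alpha + 2 * beta - 6 * gamma - 12 * psi
          - 2) *: a
        + (1 - 6 * beta) *: (b + c) + (2 * (1 - 6 * beta)) *: (p + r)
        + (4 * beta + 24 * psi + 2) *: q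
        + (8 * beta - 16 * psi + 4) *: s)
  | It, It =>
      16^-1 *: ((1 - 6 * gamma) *: (a + c)
        + (36 * alpha * gamma + 36 * beta * gamma - 4 * gamma ^+ 2
          - 24 * gamma * psi - 6 * alpha - 6 * beta + 2 * gamma - 12 * psi
          - 2) *: b
        + (2 - 12 * gamma) *: (p + q)
        + (4 * gamma + 24 * psi + 2) *: r
        + (8 * gamma - 16 * psi + 4) *: t)
  | Is, It | It, Is =>
      16^-1 *: ((12 * beta * psi - 6 * alpha * beta - 2 * beta ^+ 2
          - 14 * beta * gamma + beta + 6 * gamma + 6 * psi + 1) *: a
        + (12 * gamma * psi - 6 * alpha * gamma - 14 * beta * gamma
          - 2 * gamma ^+ 2 + 6 * beta + gamma + 6 * psi + 1) *: b
        + (18 * alpha ^+ 2 + 6 * alpha * beta + 6 * alpha * gamma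
          - 36 * alpha * psi + 3 * alpha - 6 * psi - 2) *: c
        + (6 * gamma - 6 * alpha + 6 * beta - 32 * beta * gamma
          + 12 * psi - 1) *: p
        + (24 * alpha * gamma - 6 * alpha + 2 * beta + 6 * gamma
          - 12 * psi - 1) *: q
        + (24 * alpha * beta - 6 * alpha + 6 * beta + 2 * gamma
          - 12 * psi - 1) *: r
        + (8 * gamma - 12 * alpha - 4 * beta + 16 * psi - 4) *: s
        + (8 * beta - 12 * alpha - 4 * gamma + 16 * psi - 4) *: t)
  end.

Definition table_eta (eta : F) (i j : letter) : V :=
  match i, j with
  | Ia, Ia => a
  | Ib, Ib => b
  | Ic, Ic => c
  | Ia, Ib | Ib, Ia => p
  | Ia, Ic | Ic, Ia => r
  | Ib, Ic | Ic, Ib => q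
  | Ia, Iq | Iq, Ia => s
  | Ib, Ir | Ir, Ib => t
  | Ic, Ip | Ip, Ic =>
      (eta + 1) *: (p + q + r) - eta *: (a + b + c) - s - t
  | Ia, Ip | Ip, Ia =>
      2^-1 *: ((1 - eta) *: a - eta *: b + (1 + 2 * eta) *: p)
  | Ia, Ir | Ir, Ia =>
      2^-1 *: ((1 - eta) *: a - eta *: c + (1 + 2 * eta) *: r)
  | Ib, Ip | Ip, Ib =>
      2^-1 *: ((1 - eta) *: b - eta *: a + (1 + 2 * eta) *: p)
  | Ib, Iq | Iq, Ib =>
      2^-1 *: ((1 - eta) *: b - eta *: c + (1 + 2 * eta) *: q)
  | Ic, Ir | Ir, Ic =>
      2^-1 *: ((1 - eta) *: c - eta *: a + (1 + 2 * eta) *: r)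
  | Ic, Iq | Iq, Ic =>
      2^-1 *: ((1 - eta) *: c - eta *: b + (1 + 2 * eta) *: q)
  | Ia, Is | Is, Ia =>
      2^-1 *: ((1 - eta) *: a - eta *: q + (1 + 2 * eta) *: s)
  | Ib, It | It, Ib =>
      2^-1 *: ((1 - eta) *: b - eta *: r + (1 + 2 * eta) *: t)
  | Ib, Is | Is, Ib =>
      4^-1 *: (- eta *: a + (1 - 2 * eta ^+ 2) *: b + (eta - 2 * eta ^+ 2) *: c
        + (2 * eta) *: p + (4 * eta ^+ 2 - 2 * eta) *: q - r
        + 2 *: s + 2 *: t)
  | Ic, Is | Is, Ic =>
      4^-1 *: (- (3 * eta) *: a - (2 * eta ^+ 2 + 2 * eta - 1) *: c
        + (2 * eta + 1) *: (p + 2 *: r - eta *: b)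
        + (4 * eta ^+ 2 + 2) *: q - 2 *: t)
  | Ia, It | It, Ia =>
      4^-1 *: ((1 - 2 * eta ^+ 2) *: a - eta *: b + (eta - 2 * eta ^+ 2) *: c
        + (2 * eta) *: p - q + (4 * eta ^+ 2 - 2 * eta) *: r
        + 2 *: s + 2 *: t)
  | Ic, It | It, Ic =>
      4^-1 *: (- (3 * eta) *: b - (2 * eta ^+ 2 + 2 * eta - 1) *: c
        + (2 * eta + 1) *: (p + 2 *: q - eta *: a)
        + (4 * eta ^+ 2 + 2) *: r - 2 *: s)
  | Ip, Ip =>
      4^-1 *: ((1 - 4 * eta) *: (a + b) + (8 * eta + 2) *: p)
  | Iq, Iq =>
      4^-1 *: ((1 - 4 * eta) *: (b + c) + (8 * eta + 2) *: q)
  | Ir, Ir =>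
      4^-1 *: ((1 - 4 * eta) *: (a + c) + (8 * eta + 2) *: r)
  | Ip, Iq | Iq, Ip =>
      4^-1 *: (- (3 * eta) *: (a + c) + (1 - 4 * eta) *: b
        + (2 * eta + 1) *: (2 *: p + 2 *: q + r) - 2 *: t)
  | Ip, Ir | Ir, Ip =>
      4^-1 *: ((1 - 4 * eta) *: a - (3 * eta) *: (b + c)
        + (2 * eta + 1) *: (2 *: p + q + 2 *: r) - 2 *: s)
  | Iq, Ir | Ir, Iq =>
      4^-1 *: (- eta *: (a + b) + (1 - 2 * eta) *: c - p
        + (2 * eta) *: (q + r) + 2 *: s + 2 *: t)
  | Ip, Is | Is, Ip =>
      8^-1 *: ((2 - 8 * eta) *: a - (2 * eta ^+ 2 + 5 * eta - 1) *: b
        - (2 * eta ^+ 2 + eta) *: c + (10 * eta + 2) *: p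
        + (4 * eta ^+ 2 - 2 * eta + 1) *: q + (2 * eta) *: r
        + (4 * eta + 2) *: s)
  | Iq, Is | Is, Iq =>
      8^-1 *: (- (4 * eta) *: a - (4 * eta ^+ 2 + 3 * eta - 1) *: (b + c)
        + (4 * eta - 1) *: (p + r) + (8 * eta ^+ 2 + 2 * eta + 2) *: q
        + 6 *: s)
  | Ir, Is | Is, Ir =>
      8^-1 *: ((2 - 8 * eta) *: a - (2 * eta ^+ 2 + eta) *: b
        - (2 * eta ^+ 2 + 5 * eta - 1) *: c + (2 * eta) *: p
        + (4 * eta ^+ 2 - 2 * eta + 1) *: q + (10 * eta + 2) *: r
        + (4 * eta + 2) *: s)
  | Ip, It | It, Ip =>
      8^-1 *: ((1 - 5 * eta - 2 * eta ^+ 2) *: a + (2 - 8 * eta) *: b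
        - (2 * eta ^+ 2 + eta) *: c + (10 * eta + 2) *: p + (2 * eta) *: q
        + (4 * eta ^+ 2 - 2 * eta + 1) *: r + (4 * eta + 2) *: t)
  | Iq, It | It, Iq =>
      8^-1 *: (- (2 * eta ^+ 2 + eta) *: a + (2 - 8 * eta) *: b
        + (1 - 5 * eta - 2 * eta ^+ 2) *: c + (2 * eta) *: p
        + (10 * eta + 2) *: q + (4 * eta ^+ 2 - 2 * eta + 1) *: r
        + (4 * eta + 2) *: t)
  | Ir, It | It, Ir =>
      8^-1 *: ((1 - 3 * eta - 4 * eta ^+ 2) *: (a + c) - (4 * eta) *: b
        + (4 * eta - 1) *: (p + q) + (8 * eta ^+ 2 + 2 * eta + 2) *: r
        + 6 *: t)
  | Is, Is =>
      16^-1 *: ((4 - 16 * eta) *: a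
        + (1 - 2 * eta - 8 * eta ^+ 2) *: (b + c)
        + (8 * eta - 2) *: (p + r + (2 * eta - 1) *: q)
        + (16 * eta + 12) *: s)
  | It, It =>
      16^-1 *: ((1 - 2 * eta - 8 * eta ^+ 2) *: (a + c)
        + (4 - 16 * eta) *: b
        + (8 * eta - 2) *: (p + q + (2 * eta - 1) *: r)
        + (16 * eta + 12) *: t)
  | Is, It | It, Is =>
      16^-1 *: ((2 - 8 * eta - 6 * eta ^+ 2) *: (a + b)
        + (1 - 12 * eta ^+ 2) *: c + (12 * eta - 3) *: p
        + (12 * eta ^+ 2 - 2 * eta - 1) *: (q + r)
        + (4 * eta + 8) *: (s + t))
  end.

End Tables.

Section UniversalProduct.

Variables (F : fieldType) (V : vectType F) (e : 8.-tuple V).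
Variables (eta alpha beta gamma psi : F).

Definition univ_table (i j : letter) : V :=
  if eta == -1 then
    table_m1 e`_0 e`_1 e`_2 e`_3 e`_4 e`_5 e`_6 e`_7 alpha beta gamma psi i j
  else
    table_eta e`_0 e`_1 e`_2 e`_3 e`_4 e`_5 e`_6 e`_7 eta i j.

(* Bilinear extension of the table from the basis e to V. *)
Definition univ_mul (u v : V) : V :=
  \sum_(i < 8) \sum_(j < 8) (coord e i u * coord e j v) *:
    univ_table (nth Ia letters i) (nth Ia letters j).

End UniversalProduct.

(* Main.v *)
Require Import Defs.
From HB Require Import structures.
From mathcomp Require Import all_boot all_order all_algebra.
From mathcomp Require Import ring.
Set Implicit Arguments.
Unset Strict Implicit.
Unset Printing Implicit Defensive.
Import GRing.Theory.
Local Open Scope ring_scope.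

(* Write P_g(u, v) for the identity
     g(uv) + u(gv) + v(gu) = (1 + eta)(uv + (g,u) gv + (g,v) gu)
                             - eta ((g,u) v + (g,v) u + (u,v) g).
   An idempotent g with (g,g) = 1 that satisfies P_g for a symmetric form with
   (gu,v) = (u,gv) is a primitive axis: on the orthogonal complement of g the
   identity gives (2L - 1)(L - eta) = 0 for the multiplication L by g, and its
   restrictions to the eigenspaces give the fusion rules. Conversely a primitive
   axis of an algebra with Frobenius form satisfies P_g when eta = -1. When
   eta != -1 one needs in addition that the form has rank one; this holds
   because the algebra is spanned by primitive axes (images of the generators
   under products of Miyamoto involutions) and any two of them have inner
   product 1.
   In V the identities P_a, P_b, P_c are checked on the basis, which makes
   a, b, c primitive axes. For the linear map f : V -> A given by the words in
   the basis, let D(u, v) = f(uv) - f(u) f(v). Subtracting the identity in A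
   from the image of the one in V gives D(g,uv) + D(u,gv) + D(v,gu) = 0 as soon
   as D(u,v) = D(g,u) = D(g,v) = 0, and these relations force D = 0. *)

(** * Deciding linear identities in a module *)

(** Reified linear combinations of numbered atoms. The scalars stay terms of [F], so that the
    coefficient equations left over can be handed to [ring] or [field]. *)
Inductive mexp (F : Type) :=
  | MAtom of nat
  | MZero
  | MAdd of mexp F & mexp F
  | MOpp of mexp F
  | MScale of F & mexp F.
Arguments MAtom {F}.
Arguments MZero {F}.

Section ModuleExpressions.

Variables (F : pzRingType) (V : lmodType F).

Fixpoint meval (vs : seq V) (x : mexp F) : V :=
  match x with
  | MAtom n => vs`_n
  | MZero => 0
  | MAdd x y => meval vs x + meval vs y
  | MOpp x => - meval vs x
  | MScale k x => k *: meval vs x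
  end.

Fixpoint mcoef (x : mexp F) (n : nat) : F :=
  match x with
  | MAtom m => if eqn m n then 1 else 0
  | MZero => 0
  | MAdd x y => mcoef x n + mcoef y n
  | MOpp x => - mcoef x n
  | MScale k x => k * mcoef x n
  end.

Lemma meval_mcoef (vs : seq V) (x : mexp F) :
  meval vs x = \sum_(n < size vs) mcoef x n *: vs`_n.
Proof.
elim: x => [m||x IHx y IHy|x IHx|k x IHx] /=.
- have [ltm|lem] := ltnP m (size vs).
    rewrite (bigD1 (Ordinal ltm)) //= -[eqn m m]/(m == m) eqxx scale1r.
    rewrite big1 ?addr0 // => i; rewrite -val_eqE /= => nim.
    by rewrite -[eqn _ _]/(m == i) eq_sym (negbTE nim) scale0r.
  rewrite nth_default // big1 // => i _.
  by rewrite -[eqn _ _]/(m == i) gtn_eqF ?scale0r // (leq_trans _ lem).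
- by rewrite big1 // => i _; rewrite scale0r.
- by rewrite IHx IHy -big_split; apply: eq_bigr => i _; rewrite scalerDl.
- by rewrite IHx -sumrN; apply: eq_bigr => i _; rewrite scaleNr.
- by rewrite IHx scaler_sumr; apply: eq_bigr => i _; rewrite scalerA.
Qed.

Fixpoint eq_mcoefs (x y : mexp F) (m : nat) : Prop :=
  if m is m'.+1 then mcoef x m' = mcoef y m' /\ eq_mcoefs x y m' else True.

(** Sufficient only: the atoms may be linearly dependent, so a true identity can still leave false
    coefficient equations until the dependencies have been substituted. *)
Lemma eq_meval (vs : seq V) (x y : mexp F) :
  eq_mcoefs x y (size vs) -> meval vs x = meval vs y.
Proof.
move=> eq_xy; rewrite !meval_mcoef; apply: eq_bigr => -[i /=].
elim: (size vs) eq_xy => //= m IHm [eq_m /IHm{}IHm].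
by rewrite ltnS leq_eqVlt => /predU1P[-> | /IHm //]; rewrite eq_m.
Qed.

End ModuleExpressions.

Ltac mod_index v vs :=
  lazymatch vs with
  | v :: _ => constr:(O)
  | _ :: ?vs' => let n := mod_index v vs' in constr:(S n)
  end.

Ltac mod_atoms t vs :=
  lazymatch t with
  | ?x + ?y => let vs := mod_atoms x vs in mod_atoms y vs
  | - ?x => mod_atoms x vs
  | ?k *: ?x => mod_atoms x vs
  | 0 => vs
  | ?v =>
    match vs with
    | _ => let n := mod_index v vs in vs
    | _ => constr:(v :: vs)
    end
  end.

Ltac mod_quote F t vs :=
  lazymatch t with
  | ?x + ?y =>
    let x := mod_quote F x vs in let y := mod_quote F y vs in
    constr:(MAdd x y)
  | - ?x => let x := mod_quote F x vs in constr:(MOpp x)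
  | ?k *: ?x => let x := mod_quote F x vs in constr:(MScale k x)
  | 0 => constr:(@MZero F)
  | ?v => let n := mod_index v vs in constr:(@MAtom F n)
  end.

(* Reduces an equation between linear combinations over F to the equations
   between the coefficients of its atoms. *)
Ltac mod_split F :=
  lazymatch goal with
  | |- @eq ?V ?x ?y =>
    let vs := mod_atoms x (@nil V) in
    let vs := mod_atoms y vs in
    let qx := mod_quote F x vs in
    let qy := mod_quote F y vs in
    apply: (@eq_meval _ _ vs qx qy); rewrite /=; do ?split
  end.

(** Uses a known equation with a chosen multiplier; several applications in a row prove a goal as a
    linear combination of hypotheses. *)
Lemma eq_addZ (F : fieldType) (V : lmodType F) (k : F) (x y u v : V) :
  x = y -> u + k *: x = v + k *: y -> u = v.
Proof. by move=> ->; apply: addIr. Qed.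
Arguments eq_addZ {F V} k {x y u v}.

(** * The linearized cubic identity at an axis *)

Lemma half_neq1 (F : fieldType) : 2 != 0 :> F -> 2^-1 != 1 :> F.
Proof.
move=> two_neq0; apply: contraNneq (oner_neq0 F) => e.
have : 2 * 2^-1 = 1 :> F by rewrite mulfV.
by rewrite e mulr1 => /eqP; rewrite -subr_eq0 -[2]/(1 + 1) addrK => /eqP ->.
Qed.

Lemma double_neq1 (F : fieldType) (eta : F) :
  2 != 0 :> F -> eta != 2^-1 -> eta * 2 - 1 != 0.
Proof.
move=> two_neq0; apply: contraNneq => /eqP; rewrite subr_eq0 => /eqP e.
by rewrite -[eta](mulfK two_neq0) e mul1r.
Qed.

(** * Computation rules for commutative algebras and symmetric bilinear forms *)

Section AlgebraRules.

Variables (F : fieldType) (A : lmodType F) (mul : A -> A -> A).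
Hypothesis algA : is_comm_algebra mul.

Lemma algMC u v : mul u v = mul v u.
Proof. exact: comm_algebraC algA u v. Qed.

Lemma algDr u v w : mul u (v + w) = mul u v + mul u w.
Proof.
by have /= := comm_algebra_linearr algA u 1 v w; rewrite !scale1r.
Qed.

Lemma algDl u v w : mul (u + v) w = mul u w + mul v w.
Proof. by rewrite algMC algDr ![mul w _]algMC. Qed.

Lemma alg0r u : mul u 0 = 0.
Proof. by apply: (addrI (mul u 0)); rewrite -algDr !addr0. Qed.

Lemma alg0l u : mul 0 u = 0.
Proof. by rewrite algMC alg0r. Qed.

Lemma algZr k u v : mul u (k *: v) = k *: mul u v.
Proof.
by have /= := comm_algebra_linearr algA u k v 0; rewrite alg0r !addr0.
Qed.

Lemma algZl k u v : mul (k *: u) v = k *: mul u v.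
Proof. by rewrite algMC algZr algMC. Qed.

Lemma algNr u v : mul u (- v) = - mul u v.
Proof. by rewrite -scaleN1r algZr scaleN1r. Qed.

Lemma algNl u v : mul (- u) v = - mul u v.
Proof. by rewrite algMC algNr algMC. Qed.

Definition algE := (algDl, algDr, algNl, algNr, algZl, algZr, alg0l, alg0r).

End AlgebraRules.

Section FormRules.

Variables (F : fieldType) (A : lmodType F) (B : A -> A -> F).
Hypothesis linB : forall v, scalar (B^~ v).
Hypothesis symB : forall u v, B u v = B v u.

Lemma formDl u v w : B (u + v) w = B u w + B v w.
Proof. by have /= := linB w 1 u v; rewrite scale1r mul1r. Qed.

Lemma formDr u v w : B u (v + w) = B u v + B u w.
Proof. by rewrite symB formDl ![B _ u]symB. Qed.

Lemma form0l u : B 0 u = 0.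
Proof. by apply: (addrI (B 0 u)); rewrite -formDl !addr0. Qed.

Lemma form0r u : B u 0 = 0.
Proof. by rewrite symB form0l. Qed.

Lemma formZl k u v : B (k *: u) v = k * B u v.
Proof. by have /= := linB v k u 0; rewrite form0l !addr0. Qed.

Lemma formZr k u v : B u (k *: v) = k * B u v.
Proof. by rewrite symB formZl symB. Qed.

Lemma formNl u v : B (- u) v = - B u v.
Proof. by rewrite -scaleN1r formZl mulN1r. Qed.

Lemma formNr u v : B u (- v) = - B u v.
Proof. by rewrite symB formNl symB. Qed.

Definition formE := (formDl, formDr, formNl, formNr, formZl, formZr,
  form0l, form0r).

End FormRules.

(* For eta = -1 this is the linearization of x^3 = B(x,x) x; for eta != -1,
   where B turns out to be the square of a linear form w, it is the
   linearization of x^3 - (1 + eta) w(x) x^2 + eta w(x)^2 x = 0. One of the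
   three arguments is the axis g. *)
Definition PC_identity (F : fieldType) (A : lmodType F) (mul : A -> A -> A)
    (eta : F) (B : A -> A -> F) (g : A) : Prop :=
  forall u v, mul g (mul u v) + mul u (mul g v) + mul v (mul g u) =
    (1 + eta) *: (mul u v + B g u *: mul g v + B g v *: mul g u)
    - eta *: (B g u *: v + B g v *: u + B u v *: g).

Section AxisOfIdentity.

Variables (F : fieldType) (A : lmodType F) (mul : A -> A -> A).
Hypothesis algA : is_comm_algebra mul.
Variables (eta : F) (B : A -> A -> F) (g : A).
Hypothesis two_neq0 : 2 != 0 :> F.
Hypotheses (eta_neq1 : eta != 1) (eta_neq_half : eta != 2^-1).
Hypothesis linB : forall v, scalar (B^~ v).
Hypothesis symB : forall u v, B u v = B v u.
Hypothesis invB : forall u v, B (mul g u) v = B u (mul g v).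
Hypotheses (idem_g : mul g g = g) (Bgg : B g g = 1).
Hypothesis idP : PC_identity mul eta B g.

Let mE := algE algA.
Let BE := formE linB symB.

Let eta1 : eta - 1 != 0. Proof. by rewrite subr_eq0. Qed.
Let eta12 : eta * 2 - 1 != 0 := double_neq1 two_neq0 eta_neq_half.

Let Bgmul u : B g (mul g u) = B g u.
Proof. by rewrite -invB idem_g. Qed.

(** The identity at [u = g], divided by 2. On vectors orthogonal to [g] it is the quadratic equation
    for multiplication by [g] with roots [eta] and 1/2. *)
Lemma PC_identity_square v : mul g (mul g v) =
  (eta + 2^-1) *: mul g v - (2^-1 * eta) *: v + (2^-1 * (1 - eta) * B g v) *: g.
Proof.
have := idP g v; rewrite Bgg idem_g (algMC algA v g) => e.
by apply: (eq_addZ (- 2^-1) e); mod_split F; field.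
Qed.

(** By invariance and idempotency, k (g,u) = (g,gu) = (gg,u) = (g,u). *)
Let form_eigen (k : F) u : k != 1 -> mul g u = k *: u -> B g u = 0.
Proof.
move=> k1 gu; have := Bgmul u; rewrite gu BE => /eqP.
by rewrite -subr_eq0 -[X in _ - X]mul1r -mulrBl mulf_eq0 subr_eq0 (negbTE k1)
  => /eqP.
Qed.

Let scale_cancel (k : F) (u : A) : k != 0 -> k *: u = 0 -> u = 0.
Proof. by move=> k0 ku; apply: (scalerI k0); rewrite ku scaler0. Qed.

Let half_neq1 : 2^-1 != 1 := half_neq1 two_neq0.

(** With gu = u the quadratic equation collapses to (1 - eta)/2 times the difference of the two
    sides, and [eta] is not 1. *)
Let eigen1 u : mul g u = 1 *: u -> u = B g u *: g.
Proof.
move=> gu; apply/eqP; rewrite -subr_eq0; apply/eqP.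
apply: (@scale_cancel (2^-1 * (eta - 1))); first by rewrite mulf_neq0 ?invr_eq0.
have := PC_identity_square u; rewrite gu !mE gu => /esym e.
by apply: (eq_addZ (- 1) e); mod_split F; field.
Qed.

Lemma primitive_axis_of_identity : is_primitive_axis mul eta g.
Proof.
have mulC := algMC algA.
split; last first.
- move=> u; split=> [/eigen1 -> | [k ->]]; first by exists (B g u).
  by rewrite /eigensp !mE idem_g scale1r.
- by apply: contraNneq (oner_neq0 F) => g0; rewrite -Bgg g0 BE.
split=> //.
- split=> [v|u1 u2 u3].
    pose v0 := v - B g v *: g.
    have gg0 : mul g (mul g v0) = (eta + 2^-1) *: mul g v0 - (2^-1 * eta) *: v0.
      by rewrite PC_identity_square /v0 !BE Bgg mulr1 subrr mulr0 scale0r addr0.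
    have vE : v = v0 + B g v *: g by rewrite subrK.
    clearbody v0.
    (* Lagrange interpolation at the roots [eta] and 1/2: the projections of [v0] are (L - 1/2)/(eta
       - 1/2) and (eta - L)/(eta - 1/2), where L is multiplication by [g]. *)
    exists (B g v *: g), ((2 / (eta * 2 - 1)) *: (mul g v0 - 2^-1 *: v0)),
      ((2 / (eta * 2 - 1)) *: (eta *: v0 - mul g v0)).
    rewrite /eigensp !(algDr algA, algNr algA, algZr algA) gg0 idem_g.
    split; try by mod_split F; field; rewrite ?two_neq0 ?eta12.
    rewrite {1}vE.
    by mod_split F; field; rewrite ?two_neq0 ?eta12.
  rewrite /eigensp => gu1 gu2 gu3 s0.
  have s1 : u1 + eta *: u2 + 2^-1 *: u3 = 0.
    by rewrite -[RHS](alg0r algA g) -s0 !mE gu1 gu2 gu3 scale1r.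
  have s2 : u1 + (eta * eta) *: u2 + (2^-1 * 2^-1) *: u3 = 0.
    by rewrite -[RHS](alg0r algA g) -s1 !mE gu1 gu2 gu3 scale1r !scalerA.
  have u10 : u1 = 0.
    (* The polynomial (X - eta)(X - 1/2) kills the other two components; its value at 1 is the
       factor cancelled here, and its coefficients are the multipliers below. *)
    apply: (@scale_cancel ((eta - 1) * (2^-1 - 1))).
      by rewrite mulf_neq0 // subr_eq0.
    apply: (eq_addZ (- (2^-1 * eta)) s0); apply: (eq_addZ (eta + 2^-1) s1).
    by apply: (eq_addZ (- 1) s2); mod_split F; field.
  have u20 : u2 = 0.
    apply: (@scale_cancel (eta - 2^-1)); first by rewrite subr_eq0.
    apply: (eq_addZ 2^-1 s0); apply: (eq_addZ (- 1) s1); rewrite u10.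
    by mod_split F; field.
  by move: s0; rewrite u10 u20 !add0r.
split=> u v; rewrite /eigensp.
- by move=> /eigen1 -> /eigen1 ->; rewrite !mE !idem_g scale1r.
- by move=> /eigen1 -> gv; rewrite !mE gv !mE gv !scalerA mulrC mulrA.
- by move=> /eigen1 -> gv; rewrite !mE gv !mE gv !scalerA mulrC mulrA.
- move=> gu gv; have := idP u v.
  rewrite gu gv !mE (form_eigen eta_neq1 gu) (form_eigen eta_neq1 gv).
  rewrite (mulC v u) !scale0r !addr0 !add0r; set w := mul u v => e.
  have gw : mul g w = (1 - eta) *: w - (eta * B u v) *: g.
    by apply: (eq_addZ (- 1) e); mod_split F; ring.
  have Bw : eta * B g w = - (eta * B u v).
    have := Bgmul w; rewrite {1}gw !BE Bgg => f.
    by apply: (addIr ((1 - eta) * B g w)); rewrite {2}mulrBl mul1r -[in LHS]f;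
      ring.
  have gg := PC_identity_square w; rewrite gw !mE gw idem_g in gg.
  (* By [gw] and [Bw] this vector is orthogonal to [g] and is multiplied by 1 - eta under [g].
     Inserting 1 - eta into the quadratic equation leaves the nonzero factor (2 eta - 1)^2. *)
  suff /eqP : w - B g w *: g = 0.
    by rewrite subr_eq0 => /eqP ->; rewrite !mE idem_g scale1r.
  apply: (@scale_cancel ((eta * 2 - 1) * (eta * 2 - 1))).
    by rewrite mulf_neq0.
  have {}Bw : eta * B u v = - (eta * B g w) by rewrite Bw opprK.
  rewrite Bw in gg; apply: (eq_addZ (- 2) gg).
  by mod_split F; field.
- move=> gu gv; have := idP u v.
  rewrite gu gv !mE (form_eigen eta_neq1 gu) (form_eigen half_neq1 gv).
  rewrite (mulC v u) !scale0r !addr0 !add0r => e.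
  have Buv : B u v = 0.
    have := invB u v; rewrite gu gv !BE => /eqP.
    rewrite -subr_eq0 -mulrBl mulf_eq0 subr_eq0 (negbTE eta_neq_half).
    by move/eqP.
  rewrite Buv scale0r scaler0 subr0 in e.
  by apply: (eq_addZ (- 1) e); mod_split F; field.
- move=> gu gv; have := idP u v.
  rewrite gu gv !mE (form_eigen half_neq1 gu) (form_eigen half_neq1 gv).
  rewrite (mulC v u) !scale0r !addr0 !add0r; set w := mul u v => e.
  have gw : mul g w = eta *: w - (eta * B u v) *: g.
    by apply: (eq_addZ (- 1) e); mod_split F; field.
  have Bw : B g w = eta * B g w - eta * B u v.
    by have := Bgmul w; rewrite {1}gw !BE Bgg mulr1.
  exists (B g w *: g), (w - B g w *: g); rewrite /eigensp !mE idem_g gw scale1r.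
  split=> //; last by rewrite addrC subrK.
  have {}Bw : eta * B u v = eta * B g w - B g w.
    by apply: (addrI (B g w)); rewrite {1}Bw; ring.
  by rewrite Bw; mod_split F; ring.
Qed.

End AxisOfIdentity.

(** * Primitive axes under a Frobenius form *)

Section FrobeniusAxes.

Variables (F : fieldType) (A : lmodType F) (mul : A -> A -> A).
Hypothesis algA : is_comm_algebra mul.
Variables (eta : F) (B : A -> A -> F).
Hypothesis two_neq0 : 2 != 0 :> F.
Hypotheses (eta_neq1 : eta != 1) (eta_neq_half : eta != 2^-1).
Hypothesis frobB : is_Frobenius_form mul B.
Hypothesis unitB : forall u, is_primitive_axis mul eta u -> B u u = 1.

Let mE := algE algA.
Let mulC := algMC algA.
Let symB := Frobenius_sym frobB.
Let assocB := Frobenius_assoc frobB.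
Let BE := formE (Frobenius_linearl frobB) symB.

Let eta12 : eta * 2 - 1 != 0 := double_neq1 two_neq0 eta_neq_half.

Let half_neq1 : 2^-1 != 1 := half_neq1 two_neq0.

Lemma eigensp_orthogonal a (k l : F) u v : k != l ->
  eigensp mul k a u -> eigensp mul l a v -> B u v = 0.
Proof.
rewrite /eigensp => kl au av; have := assocB u a v.
rewrite (mulC u) au av !BE => /eqP.
by rewrite -subr_eq0 -mulrBl mulf_eq0 subr_eq0 (negbTE kl) => /eqP.
Qed.

(** Primitivity makes the 1-component a multiple of [a]; as distinct eigenspaces are orthogonal and
    (a,a) = 1, pairing with [a] yields its coefficient. *)
Lemma axis_component (u : A) a : is_primitive_axis mul eta a ->
  exists u2 u3, [/\ u = B a u *: a + u2 + u3, mul a u2 = eta *: u2,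
    mul a u3 = 2^-1 *: u3, B a u2 = 0 & B a u3 = 0].
Proof.
move=> axa; have [[idem_a [dec _] _] _ line_a] := axa.
have [_ [u2 [u3 [/line_a[k ->] au2 au3 ->]]]] := dec u.
have aa : eigensp mul 1 a a by rewrite /eigensp idem_a scale1r.
have Bau2 : B a u2 = 0 by apply: eigensp_orthogonal aa au2; rewrite eq_sym.
have Bau3 : B a u3 = 0 by apply: eigensp_orthogonal aa au3; rewrite eq_sym.
exists u2, u3; rewrite !BE Bau2 Bau3 unitB // mulr1 !addr0.
by split.
Qed.

(** After splitting [u] and [v] into components, the two sides differ only in the coefficient of
    [a], by (1 + eta)(eta (u2,v2) + (u3,v3)/2). This vanishes for eta = -1, and otherwise rank one
    makes both inner products zero. *)
Lemma PC_identity_of_axis a : is_primitive_axis mul eta a ->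
  (eta != -1 -> forall u v, B u v = B a u * B a v) ->
  PC_identity mul eta B a.
Proof.
move=> axa rank1 u v; have [[idem_a _ fusion] _ line_a] := axa.
have aa := unitB axa.
have [u2 [u3 [eu au2 au3 Bau2 Bau3]]] := axis_component u axa.
have [v2 [v3 [ev av2 av3 Bav2 Bav3]]] := axis_component v axa.
have Bu2v3 : B u2 v3 = 0 by exact: eigensp_orthogonal au2 av3.
have Bu3v2 : B u3 v2 = 0 by rewrite symB; exact: eigensp_orthogonal av2 au3.
(* The fusion law gives a multiple of [a]; the scalar is found by pairing with [a]. The same method
   gives the [a]-part of [e33]. *)
have e22 : mul u2 v2 = (eta * B u2 v2) *: a.
  have [k e] := (line_a _).1 (fusion_eta_eta fusion au2 av2).
  have : B a (mul u2 v2) = eta * B u2 v2 by rewrite -assocB au2 BE.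
  by rewrite e BE aa mulr1 => ->.
have [w e33 aw] : exists2 w,
    mul u3 v3 = (2^-1 * B u3 v3) *: a + w & mul a w = eta *: w.
  have [_ [w [/line_a[k ->] aw e]]] := fusion_half_half fusion au3 av3.
  have Baw : B a w = 0.
    apply: (@eigensp_orthogonal a 1 eta) => //; first by rewrite eq_sym.
    by rewrite /eigensp idem_a scale1r.
  have : B a (mul u3 v3) = 2^-1 * B u3 v3 by rewrite -assocB au3 BE.
  by rewrite e !BE aa Baw mulr1 addr0 => <-; exists w.
have e23 := fusion_eta_half fusion au2 av3.
have e32 : mul a (mul u3 v2) = 2^-1 *: mul u3 v2.
  by rewrite (mulC u3); exact (fusion_eta_half fusion av2 au3).
rewrite /eigensp in e23.
have Buv : B u v = B a u * B a v + B u2 v2 + B u3 v3.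
  rewrite {1}eu {1}ev !BE !(Bav2, Bav3, Bu2v3, Bu3v2, symB _ a, Bau2, Bau3) aa.
  by ring.
have e : eta = -1 \/ B u2 v2 = 0 /\ B u3 v3 = 0.
  have [->|/rank1 r] := eqVneq eta (-1); first by left.
  by right; rewrite (r u2) (r u3) Bau2 Bau3 !mul0r.
rewrite {}Buv; move: (B a u) (B a v) eu ev => k l eu ev.
move: (B u2 v2) (B u3 v3) e22 e33 e => x y e22 e33 e.
(* Free coefficients let one formula serve for uv, u(av) and v(au), since multiplication by [a] only
   rescales components. *)
have prod k' i j l' i' j' :
    mul (k' *: a + i *: u2 + j *: u3) (l' *: a + i' *: v2 + j' *: v3) =
    (k' * l' + i * i' * eta * x + j * j' * 2^-1 * y) *: a
    + (k' * i' * eta) *: v2 + (l' * i * eta) *: u2 + (j * j') *: w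
    + (k' * j' * 2^-1) *: v3 + (l' * j * 2^-1) *: u3
    + (i * j') *: mul u2 v3 + (j * i') *: mul u3 v2.
  rewrite !mE idem_a (mulC u2 a) (mulC u3 a) au2 au3 av2 av3 e22 e33.
  by mod_split F; ring.
have au : mul a u = k *: a + eta *: u2 + 2^-1 *: u3.
  by rewrite eu !mE idem_a au2 au3.
have av : mul a v = l *: a + eta *: v2 + 2^-1 *: v3.
  by rewrite ev !mE idem_a av2 av3.
rewrite -[u2]scale1r -[u3]scale1r in eu.
rewrite -[v2]scale1r -[v3]scale1r in ev.
rewrite (mulC v) au av.
rewrite eu ev !prod.
rewrite !(algDr algA, algZr algA) idem_a au2 au3 av2 av3 aw e23 e32.
by case: e => [-> | [-> ->]]; mod_split F; field.
Qed.

(** The Miyamoto involution of [a]: the identity on the 1- and [eta]-parts, minus the identity on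
    the 1/2-part. The bracket equals (1/2 - eta) times the 1/2-component, so twice that component is
    subtracted. This closed form makes linearity immediate. *)
Definition miyamoto (a u : A) : A :=
  u - (4 / (1 - 2 * eta)) *: (mul a u - eta *: u - ((1 - eta) * B a u) *: a).

Lemma miyamoto_linear a (k : F) u v :
  miyamoto a (k *: u + v) = k *: miyamoto a u + miyamoto a v.
Proof. by rewrite /miyamoto !mE !BE; mod_split F; ring. Qed.

Section Miyamoto.

Variable a : A.
Hypothesis axa : is_primitive_axis mul eta a.

Let tau := miyamoto a.

Let denom_neq0 : 1 - 2 * eta != 0.
Proof. by rewrite subr_eq0 eq_sym mulrC -subr_eq0. Qed.

Lemma miyamoto_component u2 u3 (k : F) :
  mul a u2 = eta *: u2 -> mul a u3 = 2^-1 *: u3 ->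
  tau (k *: a + u2 + u3) = k *: a + u2 - u3.
Proof.
move=> au2 au3; have [[idem_a _ _] _ _] := axa.
have aa : eigensp mul 1 a a by rewrite /eigensp idem_a scale1r.
have Bau2 : B a u2 = 0 by apply: eigensp_orthogonal aa au2; rewrite eq_sym.
have Bau3 : B a u3 = 0 by apply: eigensp_orthogonal aa au3; rewrite eq_sym.
rewrite /tau /miyamoto !mE !BE idem_a au2 au3 Bau2 Bau3 unitB //.
by mod_split F; field; rewrite ?two_neq0 ?denom_neq0.
Qed.

Lemma miyamotoK : involutive tau.
Proof.
move=> u; have [u2 [u3 [eu au2 au3 _ _]]] := axis_component u axa.
rewrite eu miyamoto_component // miyamoto_component ?opprK //.
by rewrite !mE au3 scalerN.
Qed.

(** The fusion law is graded by Z/2, with the 1/2-eigenspace as the odd part. *)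
Lemma miyamotoM u v : tau (mul u v) = mul (tau u) (tau v).
Proof.
have [[idem_a _ fusion] _ line_a] := axa.
have [u2 [u3 [-> au2 au3 _ _]]] := axis_component u axa.
have [v2 [v3 [-> av2 av3 _ _]]] := axis_component v axa.
rewrite !miyamoto_component //; move: (B a u) (B a v) => k l.
have [k22 e22] := (line_a _).1 (fusion_eta_eta fusion au2 av2).
have [_ [w [/line_a[k33 ->] aw e33]]] := fusion_half_half fusion au3 av3.
have e23 := fusion_eta_half fusion au2 av3.
have e32 : mul a (mul u3 v2) = 2^-1 *: mul u3 v2.
  by rewrite (mulC u3); exact (fusion_eta_half fusion av2 au3).
rewrite /eigensp in e23.
(* The product sorted into its multiple of [a], its [eta]-part and its odd part. *)
transitivity (tau ((k * l + k22 + k33) *: a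
    + (k * eta *: v2 + l * eta *: u2 + w)
    + (k / 2 *: v3 + l / 2 *: u3 + mul u2 v3 + mul u3 v2))).
  congr tau; rewrite !mE idem_a (mulC u2 a) (mulC u3 a) au2 au3 av2 av3 e22 e33.
  by mod_split F; ring.
rewrite miyamoto_component; last 2 first.
- by rewrite !mE au2 av2 aw; mod_split F; ring.
- by rewrite !mE au3 av3 e23 e32; mod_split F; ring.
rewrite !mE idem_a (mulC u2 a) (mulC u3 a) au2 au3 av2 av3 e22 e33.
by mod_split F; ring.
Qed.

Let tauZD k u v : tau (k *: u + v) = k *: tau u + tau v.
Proof. exact: miyamoto_linear. Qed.
Let tauD u v : tau (u + v) = tau u + tau v.
Proof. by have := tauZD 1 u v; rewrite !scale1r. Qed.
Let tau0 : tau 0 = 0.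
Proof. by apply: (addrI (tau 0)); rewrite -tauD !addr0. Qed.
Let tauZ k u : tau (k *: u) = k *: tau u.
Proof. by have := tauZD k u 0; rewrite tau0 !addr0. Qed.

Let eigensp_tau (k : F) b u :
  eigensp mul k (tau b) u <-> eigensp mul k b (tau u).
Proof.
rewrite /eigensp; split=> e.
  by rewrite -[b in LHS]miyamotoK -miyamotoM e tauZ.
by rewrite -[u in LHS]miyamotoK -miyamotoM e tauZ miyamotoK.
Qed.

(** An involutive automorphism carries the eigenspaces of [b] onto those of its image, and with them
    the decomposition, the fusion law and primitivity. *)
Lemma primitive_axis_miyamoto b :
  is_primitive_axis mul eta b -> is_primitive_axis mul eta (tau b).
Proof.
case=> -[idem_b [dec dir] [f11 f1e f1h fee feh fhh]] b0 line_b.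
have E := eigensp_tau.
split.
- split; first by rewrite -miyamotoM idem_b.
    split=> [v|u1 u2 u3].
      have [u1 [u2 [u3 [e1 e2 e3 ev]]]] := dec (tau v).
      exists (tau u1), (tau u2), (tau u3); split; rewrite ?E ?miyamotoK //.
      by rewrite -[v]miyamotoK ev !tauD.
    rewrite !E => e1 e2 e3 s0.
    have [|p1 p2 p3] := dir _ _ _ e1 e2 e3; first by rewrite -!tauD s0 tau0.
    by split; rewrite -[LHS]miyamotoK (p1, p2, p3) tau0.
  split=> u v; rewrite !E => eu ev; rewrite ?E ?miyamotoM;
    [exact: f11|exact: f1e|exact: f1h|exact: fee|exact: feh|].
  have [w1 [w2 [e1 e2 ew]]] := fhh _ _ eu ev.
  exists (tau w1), (tau w2); split; rewrite ?E ?miyamotoK //.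
  by rewrite -tauD -ew -miyamotoM miyamotoK.
- by apply: contraNneq b0 => e; rewrite -[b]miyamotoK e tau0.
move=> u; rewrite E line_b; split=> -[k e]; exists k.
  by rewrite -tauZ -e miyamotoK.
by rewrite e tauZ miyamotoK.
Qed.

End Miyamoto.

(** The linear span of the primitive axes, encoded as membership in every subspace containing them,
    so that membership is itself an induction principle. *)
Definition axial_span (u : A) : Prop := forall T : A -> Prop, T 0 ->
  (forall (k : F) v w, T v -> T w -> T (k *: v + w)) ->
  (forall a, is_primitive_axis mul eta a -> T a) -> T u.

Lemma axial_span0 : axial_span 0.
Proof. by []. Qed.

Lemma axial_span_linear (k : F) u v :
  axial_span u -> axial_span v -> axial_span (k *: u + v).
Proof.
by move=> Su Sv T T0 TD Ta; exact: TD (Su T T0 TD Ta) (Sv T T0 TD Ta).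
Qed.

Lemma axial_span_axis a : is_primitive_axis mul eta a -> axial_span a.
Proof. by move=> axa T _ _; apply. Qed.

(* The product of two axes a, b is a combination of a, b and the image of b
   under the Miyamoto involution of a, which is again a primitive axis. *)
Lemma axial_span_mul u v : axial_span u -> axial_span v ->
  axial_span (mul u v).
Proof.
have d0 : 1 - 2 * eta != 0 by rewrite subr_eq0 eq_sym mulrC -subr_eq0.
have n4 : 4 != 0 :> F by rewrite (natrM F 2 2) mulf_neq0.
move=> Su Sv; apply: (Su (fun u' => axial_span (mul u' v))).
- by rewrite !mE; apply: axial_span0.
- by move=> k u' w Tu Tw; rewrite !mE; apply: axial_span_linear.
move=> a axa; apply: (Sv (fun v' => axial_span (mul a v'))).
- by rewrite !mE; apply: axial_span0.
- by move=> k v' w Tv Tw; rewrite !mE; apply: axial_span_linear.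
move=> b axb.
have -> : mul a b = (- ((1 - 2 * eta) / 4)) *: miyamoto a b
    + (((1 + 2 * eta) / 4) *: b + (((1 - eta) * B a b) *: a + 0)).
  by rewrite /miyamoto; mod_split F; field; rewrite ?d0 ?n4.
apply: axial_span_linear.
  by apply: axial_span_axis; apply: primitive_axis_miyamoto.
apply: axial_span_linear; first exact: axial_span_axis.
exact: axial_span_linear (axial_span_axis axa) axial_span0.
Qed.

(** The span is a subalgebra by [axial_span_mul], and it contains the generators. *)
Lemma axial_span_full (X : A -> Prop) : generates mul X ->
  (forall a, X a -> is_primitive_axis mul eta a) -> forall u, axial_span u.
Proof.
move=> gen axX; apply: gen => [|a /axX]; last exact: axial_span_axis.
split; [exact: axial_span0|exact: axial_span_linear|exact: axial_span_mul].
Qed.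

(** Write b = k a + u2 + u3 with k = (a,b). Idempotency of [b] paired with [a], [u2] and [u3],
    together with (b,b) = 1, gives four scalar relations between k, (u2,u2), (u3,u3) and (u3,u2 u3).
    Eliminating all but k leaves 2 (1 + eta)(1 - k)^3 = 0. *)
Lemma form_axes a b : is_primitive_axis mul eta a ->
  is_primitive_axis mul eta b -> eta != -1 -> B a b = 1.
Proof.
move=> axa axb etaN1; have [[idem_a _ fusion] _ line_a] := axa.
have [idem_b _ _] := primitive_axis_axis axb.
have aa := unitB axa; have bb := unitB axb.
have [u2 [u3 [eb au2 au3 Bau2 Bau3]]] := axis_component b axa.
have B23 : B u2 u3 = 0 by exact: eigensp_orthogonal au2 au3.
have e23 := fusion_eta_half fusion au2 au3.
have ah : eigensp mul 1 a a by rewrite /eigensp idem_a scale1r.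
have Ba23 : B a (mul u2 u3) = 0.
  by apply: eigensp_orthogonal ah e23; rewrite eq_sym.
have B2_23 : B u2 (mul u2 u3) = 0 by exact: eigensp_orthogonal au2 e23.
have [B2_22 B3_22] : B u2 (mul u2 u2) = 0 /\ B u3 (mul u2 u2) = 0.
  have [k ->] := (line_a _).1 (fusion_eta_eta fusion au2 au2).
  by rewrite !BE !(symB _ a) Bau2 Bau3 mulr0.
have B3_33 : B u3 (mul u3 u3) = 0.
  have [_ [w [/line_a[k ->] aw ->]]] := fusion_half_half fusion au3 au3.
  rewrite !BE [B u3 a]symB Bau3 mulr0 add0r symB.
  exact: eigensp_orthogonal aw au3.
have B2_33 : B u2 (mul u3 u3) = B u3 (mul u2 u3).
  by rewrite -assocB symB.
have Ba22 : B a (mul u2 u2) = eta * B u2 u2 by rewrite -assocB au2 BE.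
have Ba33 : B a (mul u3 u3) = 2^-1 * B u3 u3 by rewrite -assocB au3 BE.
have Bb u : B u b = B a b * B a u + B u2 u + B u3 u.
  by rewrite {1}eb !BE !(symB u).
have ab : mul a b = B a b *: a + eta *: u2 + 2^-1 *: u3.
  by rewrite {1}eb !mE idem_a au2 au3.
have u2b : mul u2 b = (B a b * eta) *: u2 + mul u2 u2 + mul u2 u3.
  by rewrite {1}eb !mE (mulC u2 a) au2 scalerA.
have u3b : mul u3 b = (B a b / 2) *: u3 + mul u2 u3 + mul u3 u3.
  by rewrite {1}eb !mE (mulC u3 a) au3 scalerA (mulC u3 u2).
have eab : B (mul a b) b = B a b by rewrite assocB idem_b.
have eu2b : B (mul u2 b) b = B u2 b by rewrite assocB idem_b.
have eu3b : B (mul u3 b) b = B u3 b by rewrite assocB idem_b.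
move: eab; rewrite ab (Bb (_ + _)) !BE.
rewrite !(Bau2, Bau3, aa, symB _ a, B23, symB u3 u2).
move: eu2b; rewrite u2b (Bb (_ + _)) (Bb u2) !BE.
rewrite !(Bau2, Bau3, Ba23, Ba22, B23, symB u3 u2, B2_22, B3_22, B2_23).
move: eu3b; rewrite u3b (Bb (_ + _)) (Bb u3) !BE.
rewrite !(Bau2, Bau3, Ba23, Ba33, B23, B2_33, B3_33, B2_23).
move: bb; rewrite (Bb b) (Bb u2) (Bb u3) !(Bau2, Bau3, B23, symB u3 u2).
move: (B a b) (B u2 u2) (B u3 u3) (B u3 (mul u2 u3)) => k x y z.
rewrite !(mulr0, mulr1, addr0, add0r) => e1 e3 e2 e4.
have {e1} ey : y = 1 - k * k - x by rewrite -e1; ring.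
have {e2} ez : z = x - 2 * k * eta * x by rewrite -{1}e2; ring.
rewrite {y}ey {z}ez in e3 e4.
have {e4} ex : (2 * eta - 1) * x = - (1 - k) ^+ 2.
  by apply: (addrI (2 * k)); rewrite -{2}e4; field.
have {}e3 : (1 - k) * (1 - k * k) = x * (1 - k + 2 - 4 * k * eta).
  apply/eqP; rewrite -subr_eq0; apply/eqP; move/eqP: e3.
  by rewrite eq_sym -subr_eq0 => /eqP <-; field.
(* Multiply [e3] by 2 eta - 1 and replace (2 eta - 1) x by [ex]. *)
have : 2 * (1 + eta) * (1 - k) ^+ 3 = 0.
  transitivity ((2 * eta - 1) * ((1 - k) * (1 - k * k))
    - ((2 * eta - 1) * x) * (1 - k + 2 - 4 * k * eta)).
    by rewrite ex; ring.
  by rewrite e3; ring.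
have eta1 : 1 + eta != 0 by rewrite addrC -[1]opprK subr_eq0.
move/eqP; rewrite 2!mulf_eq0 (negbTE two_neq0) (negbTE eta1) /= expf_eq0 /=.
by rewrite subr_eq0 => /eqP.
Qed.

(** By [form_axes] the functionals (b,.) of all primitive axes agree on axes, which span the
    algebra; so the form is the square of this common functional. *)
Lemma form_rank1 (X : A -> Prop) a : generates mul X ->
  (forall a, X a -> is_primitive_axis mul eta a) ->
  is_primitive_axis mul eta a -> eta != -1 ->
  forall u v, B u v = B a u * B a v.
Proof.
move=> gen axX axa etaN1.
have full := axial_span_full gen axX.
have Bax b u : is_primitive_axis mul eta b -> B b u = B a u.
  move=> axb; apply: (full u (fun u => B b u = B a u)).
  - by rewrite !BE.
  - by move=> k v w Tv Tw; rewrite !BE Tv Tw.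
  - by move=> c axc; rewrite !form_axes.
move=> u v; apply: (full u (fun u => B u v = B a u * B a v)).
- by rewrite !BE mul0r.
- by move=> k w w' Tw Tw'; rewrite !BE Tw Tw'; ring.
- by move=> b axb; rewrite (form_axes axa axb) // mul1r Bax.
Qed.

End FrobeniusAxes.

(** * Extending a linear map to a homomorphism *)

Section LinearToHomomorphism.

Variables (F : fieldType) (V A : lmodType F).
Variables (mV : V -> V -> V) (mA : A -> A -> A).
Hypotheses (algV : is_comm_algebra mV) (algA : is_comm_algebra mA).
Variables (eta : F) (BV : V -> V -> F) (BA : A -> A -> F).
Hypothesis two_neq0 : 2 != 0 :> F.
Hypothesis assocBA : forall u v w, BA (mA u v) w = BA u (mA v w).
Variables (f : {linear V -> A}) (a b c : V).

Let p := mV a b.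
Let q := mV b c.
Let r := mV a c.
Let s := mV a q.
Let t := mV b r.
Let gens := [:: a; b; c].

Hypothesis invBV : forall g u v, g \in gens -> BV (mV g u) v = BV u (mV g v).
Hypothesis idem : forall g, g \in gens -> mV g g = g.
Hypothesis unit : forall g, g \in gens -> BV g g = 1.
Hypothesis idPV : forall g, g \in gens -> PC_identity mV eta BV g.
Hypothesis idPA : forall g, g \in gens -> PC_identity mA eta BA (f g).
Hypothesis formf : forall g v, g \in gens -> BA (f g) (f v) = BV g v.
Hypothesis spanV : forall T : V -> Prop,
  (forall (k : F) u v, T u -> T v -> T (k *: u + v)) ->
  T a -> T b -> T c -> T p -> T q -> T r -> T s -> T t -> forall v, T v.

Hypotheses (faa : f (mV a a) = mA (f a) (f a)).
Hypotheses (fbb : f (mV b b) = mA (f b) (f b)).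
Hypotheses (fcc : f (mV c c) = mA (f c) (f c)).
Hypotheses (fab : f p = mA (f a) (f b)) (fbc : f q = mA (f b) (f c)).
Hypotheses (fac : f r = mA (f a) (f c)).
Hypotheses (faq : f s = mA (f a) (f q)) (fbr : f t = mA (f b) (f r)).

Let D (u v : V) : A := f (mV u v) - mA (f u) (f v).

Let D_eq u v : D u v = 0 <-> f (mV u v) = mA (f u) (f v).
Proof.
by rewrite /D; split=> [/eqP|->]; rewrite ?subrr // subr_eq0 => /eqP.
Qed.

Let fD u v : f (u + v) = f u + f v. Proof. exact: linearD. Qed.
Let fN u : f (- u) = - f u. Proof. exact: linearN. Qed.
Let fZ k u : f (k *: u) = k *: f u. Proof. exact: linearZ. Qed.

Let DC u v : D u v = D v u.
Proof. by rewrite /D (algMC algV) (algMC algA). Qed.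

Let DD u v w : D u (v + w) = D u v + D u w.
Proof. by rewrite /D (algDr algV) !fD (algDr algA); mod_split F; ring. Qed.

Let DZ u k v : D u (k *: v) = k *: D u v.
Proof. by rewrite /D (algZr algV) !fZ (algZr algA); mod_split F; ring. Qed.

Let DN u v : D u (- v) = - D u v.
Proof. by rewrite -scaleN1r DZ scaleN1r. Qed.

(* Subtracts the image under f of the identity in V from the identity in A. *)
Let D_identity g u v : g \in gens -> BA (f u) (f v) = BV u v ->
  D u v = 0 -> D g v = 0 -> D g u = 0 ->
  D g (mV u v) + D u (mV g v) + D v (mV g u) = 0.
Proof.
move=> gG Buv /D_eq uv /D_eq gv /D_eq gu.
have eV := congr1 f (idPV gG u v); have eA := idPA gG (f u) (f v).
rewrite !(formf _ gG) Buv in eA.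
rewrite !(fD, fN, fZ) uv gv gu in eV.
apply: (eq_addZ (- 1) eV); apply: (eq_addZ 1 eA).
by rewrite /D uv gv gu; mod_split F; ring.
Qed.

Let ga : a \in gens. Proof. by rewrite !inE eqxx. Qed.
Let gb : b \in gens. Proof. by rewrite !inE eqxx orbT. Qed.
Let gc : c \in gens. Proof. by rewrite !inE eqxx !orbT. Qed.

Let double_eq0 (w : A) : w + w = 0 -> w = 0.
Proof.
move=> ww; apply: (scalerI two_neq0); rewrite scaler0 -[RHS]ww.
by mod_split F; ring.
Qed.

(** With one argument equal to [g], [D_identity] reads 2 D(g,gu) + D(u,g) = 0. *)
Let D_square g u : g \in gens -> D g u = 0 -> D g g = 0 -> D g (mV g u) = 0.
Proof.
move=> gG gu gg; have := D_identity gG (formf u gG) gu gu gg.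
by rewrite idem // (DC u) gu addr0 => /double_eq0.
Qed.

Let square_in_span g u : g \in gens -> mV g (mV g u) =
  (eta + 2^-1) *: mV g u - (2^-1 * eta) *: u + (2^-1 * (1 - eta) * BV g u) *: g.
Proof.
move=> gG; apply: (PC_identity_square algV two_neq0 (idem gG) (unit gG)).
exact: idPV.
Qed.

Let D_square_in_span u g v : g \in gens -> D u g = 0 -> D u v = 0 ->
  D u (mV g v) = 0 -> D u (mV g (mV g v)) = 0.
Proof.
move=> gG ug uv ugv.
by rewrite square_in_span // !DD DN !DZ ug uv ugv !scaler0 oppr0 !addr0.
Qed.

(** First [D] is shown to vanish for a generator against each spanning word, hence against
    everything. Then D(g,.) = D(w,.) = 0 implies D(gw,.) = 0, which passes from the generators to
    [p], [q], [r] and from these to [s], [t]. *)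
Lemma linear_to_homomorphism u v : f (mV u v) = mA (f u) (f v).
Proof.
have Daa : D a a = 0 by apply/D_eq.
have Dbb : D b b = 0 by apply/D_eq.
have Dcc : D c c = 0 by apply/D_eq.
have Dab : D a b = 0 by apply/D_eq.
have Dbc : D b c = 0 by apply/D_eq.
have Dac : D a c = 0 by apply/D_eq.
have Daq : D a q = 0 by apply/D_eq.
have Dbr : D b r = 0 by apply/D_eq.
have [Dba [Dcb Dca]] : D b a = 0 /\ D c b = 0 /\ D c a = 0.
  by rewrite ![_ _ a]DC (DC c).
have qC : mV c b = q by apply: algMC algV _ _.
have pC : mV b a = p by apply: algMC algV _ _.
have rC : mV c a = r by apply: algMC algV _ _.
have Dap : D a p = 0 by exact: D_square.
have Dbp : D b p = 0 by rewrite -pC D_square.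
have Dbq : D b q = 0 by exact: D_square.
have Dcq : D c q = 0 by rewrite -qC D_square.
have Dar : D a r = 0 by exact: D_square.
have Dcr : D c r = 0 by rewrite -rC D_square.
have Das : D a s = 0 by exact: D_square.
have Dbt : D b t = 0 by exact: D_square.
have Dcp : D c p = 0.
  have := D_identity ga (formf c gb) Dbc Dac Dab.
  by rewrite -/q -/r -/p Daq Dbr !add0r.
(* The identity at [a] applied to [b] and [c]: its left side is s + t + cp. *)
have cpE : mV c p = (1 + eta) *: (q + BV a b *: r + BV a c *: p)
    - eta *: (BV a b *: c + BV a c *: b + BV b c *: a) - s - t.
  apply: (eq_addZ (- 1) (idPV ga b c)); rewrite -/q -/r -/p -/s -/t.
  by mod_split F; ring.
have Dcp_of u' : D u' a = 0 -> D u' b = 0 -> D u' c = 0 -> D u' p = 0 ->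
    D u' q = 0 -> D u' r = 0 -> D u' (mV c p) = - D u' s - D u' t.
  move=> ua ub uc up uq ur; rewrite cpE !(DD, DN, DZ) ua ub uc up uq ur.
  by rewrite !(scaler0, addr0, oppr0, add0r).
have opposite (w w' : A) : w + w' = 0 -> - w + w' = 0 -> w = 0 /\ w' = 0.
  move=> e1 e2; have w'0 : w' = 0.
    apply: double_eq0; apply: (eq_addZ (- 1) e1); apply: (eq_addZ (- 1) e2).
    by mod_split F; ring.
  by move: e1; rewrite w'0 addr0.
(* The relation at [b] for the pair (a,q) gives D(b,s) + D(p,q) = 0; for (c,p), after expanding cp,
   it gives -D(b,s) + D(p,q) = 0. The next pair is the analogue at [a]. *)
have [Dbs Dpq] : D b s = 0 /\ D p q = 0.
  apply: opposite.
    have := D_identity gb (formf q ga) Daq Dbq Dba.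
    rewrite -/s pC (DC q) (D_square_in_span gb) ?addr0 //.
  have := D_identity gb (formf p gc) Dcp Dbp Dbc.
  rewrite -/q Dcp_of // Dbt subr0 -pC (D_square_in_span gb) ?pC //.
  by rewrite addr0.
have [Dat Dpr] : D a t = 0 /\ D p r = 0.
  apply: opposite.
    have := D_identity ga (formf r gb) Dbr Dar Dab.
    by rewrite -/t -/p (DC r) (D_square_in_span ga) ?addr0 // DC.
  have := D_identity ga (formf p gc) Dcp Dap Dac.
  rewrite -/r Dcp_of // Das oppr0 add0r (D_square_in_span ga) ?addr0 // DC.
(* Here [e1] and [e2] share the term D(q,r), so D(c,s) = D(c,t), while [e3] makes their sum zero. *)
have [Dct Dcs] : D c t = 0 /\ D c s = 0.
  have e1 : D c s + D q r = 0.
    have := D_identity gc (formf q ga) Daq Dcq Dca.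
    rewrite -/s rC -qC (D_square_in_span gc) ?qC ?addr0 //.
  have e2 : D c t + D r q = 0.
    have := D_identity gc (formf r gb) Dbr Dcr Dcb.
    rewrite -/t qC -rC (D_square_in_span gc) ?rC ?addr0 // DC.
  have e3 : D c s + D c t = 0.
    have := D_identity gc (formf p gc) Dcp Dcp Dcc.
    rewrite (idem gc) (DC p) Dcp addr0 => /double_eq0.
    rewrite Dcp_of // => e; rewrite -[LHS]opprK -oppr0 -e.
    by mod_split F; ring.
  apply: opposite; first by rewrite addrC.
  rewrite (DC r) in e2; apply: (eq_addZ 1 e2); apply: (eq_addZ (- 1) e1).
  by mod_split F; ring.
have M_gen g : D g a = 0 -> D g b = 0 -> D g c = 0 ->
  D g p = 0 -> D g q = 0 -> D g r = 0 -> D g s = 0 -> D g t = 0 ->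
  forall w, D g w = 0.
  move=> *; apply: (@spanV (fun w => D g w = 0)) => // k x y gx gy.
  by rewrite DD DZ gx gy scaler0 addr0.
have Ma w : D a w = 0 by apply: M_gen.
have Mb w : D b w = 0 by apply: M_gen => //; rewrite DC.
have Mc w : D c w = 0 by apply: M_gen => //; rewrite DC.
have M_mul g w x : g \in gens -> (forall y, D g y = 0) ->
    (forall y, D w y = 0) -> BA (f w) (f x) = BV w x -> D (mV g w) x = 0.
  move=> gG Mg Mw Bwx; have := D_identity gG Bwx (Mw x) (Mg x) (Mg w).
  by rewrite Mg Mw !add0r DC.
have Mp w : D p w = 0 by apply: M_mul => //; apply: formf.
have Mq w : D q w = 0 by apply: M_mul => //; apply: formf.
have Mr w : D r w = 0 by apply: M_mul => //; apply: formf.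
(* To apply [M_mul] with the non-generator [q], the forms must agree on [q] as well: associativity
   moves [c] to the other side, where [Mc] and [formf] at [b] apply. *)
have Bqf w : BA (f q) (f w) = BV q w.
  by rewrite fbc assocBA -((D_eq _ _).1 (Mc w)) formf // -qC invBV.
have Brf w : BA (f r) (f w) = BV r w.
  by rewrite fac assocBA -((D_eq _ _).1 (Mc w)) formf // -rC invBV.
have Ms w : D s w = 0 by apply: M_mul.
have Mt w : D t w = 0 by apply: M_mul.
apply/D_eq; move: u; apply: (@spanV (fun w => D w v = 0)) => // k x y xv yv.
by rewrite DC DD DZ ![D v _]DC xv yv scaler0 addr0.
Qed.

End LinearToHomomorphism.

(** * The tables *)

Section Tables.

Variables (F : fieldType) (eta alpha beta gamma psi : F).
Hypothesis two_neq0 : 2 != 0 :> F.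
Hypothesis parameters :
  eta != -1 -> [/\ alpha = 1, beta = 1, gamma = 1 & psi = 1].

(** The basis is replaced by an arbitrary family [h]. When [h] lists the values of a linear
    functional on the basis, the table gives its values on products, so vector identities become
    identities in [F]. *)
Definition table (V : lmodType F) (h : letter -> V) (i j : letter) : V :=
  if eta == -1 then
    table_m1 (h Ia) (h Ib) (h Ic) (h Ip) (h Iq) (h Ir) (h Is) (h It)
      alpha beta gamma psi i j
  else
    table_eta (h Ia) (h Ib) (h Ic) (h Ip) (h Iq) (h Ir) (h Is) (h It) eta i j.

Lemma tableC (V : lmodType F) (h : letter -> V) i j :
  table h i j = table h j i.
Proof. by rewrite /table; case: ifP => _; case: i; case: j. Qed.

Lemma table_linear (V W : lmodType F) (g : V -> W) (h : letter -> V) i j :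
  linear g -> g (table h i j) = table (g \o h) i j.
Proof.
move=> gL; have g0 : g 0 = 0.
  by have := gL (-1) 0 0; rewrite scaler0 addr0 scaleN1r addNr.
have gD u v : g (u + v) = g u + g v by have := gL 1 u v; rewrite !scale1r.
have gZ k u : g (k *: u) = k *: g u by have := gL k u 0; rewrite g0 !addr0.
have gN u : g (- u) = - g u by rewrite -scaleN1r gZ scaleN1r.
by rewrite /table; case: ifP => _; case: i; case: j; rewrite /= ?(gD, gZ, gN).
Qed.

Definition gram_a (l : letter) : F^o :=
  match l with
  | Ia => 1 | Ib => alpha | Ic => gamma | Ip => alpha | Iq => psi
  | Ir => gamma | Is => psi | It => alpha * gamma + (beta - psi) / 2
  end.

Definition gram_b (l : letter) : F^o :=
  match l with
  | Ia => alpha | Ib => 1 | Ic => beta | Ip => alpha | Iq => beta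
  | Ir => psi | Is => alpha * beta + (gamma - psi) / 2 | It => psi
  end.

Definition gram_c (l : letter) : F^o :=
  match l with
  | Ia => gamma | Ib => beta | Ic => 1 | Ip => psi | Iq => beta
  | Ir => gamma | Is | It => beta * gamma + (alpha - psi) / 2
  end.

(* The last entries above come from (a, t) = (p, r) = (b, a r), and the rows
   below from (u v, w) = (v, u w). *)
Definition gram (i j : letter) : F^o :=
  match i with
  | Ia => gram_a j
  | Ib => gram_b j
  | Ic => gram_c j
  | Ip => table gram_a Ib j
  | Iq => table gram_b Ic j
  | Ir => table gram_a Ic j
  | Is => table gram_a Iq j
  | It => table gram_b Ir j
  end.

Definition is_gen (g : letter) : bool :=
  if g is (Ia | Ib | Ic) then true else false.

Let scaleE : @GRing.scale F F^o = @GRing.mul F. Proof. by []. Qed.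

Let denominators :
  (4 != 0 :> F) * (8 != 0 :> F) * (16 != 0 :> F) * (2 != 0 :> F).
Proof.
have n4 : 4 != 0 :> F by rewrite (natrM F 2 2) mulf_neq0.
have n8 : 8 != 0 :> F by rewrite (natrM F 2 4) mulf_neq0.
by rewrite (natrM F 2 8) mulf_neq0.
Qed.

(** In the list for eta other than -1 the coefficients of each product sum to 1: the functional with
    value 1 on the basis is multiplicative. *)
Lemma table_one (h : letter -> F^o) i j :
  eta != -1 -> (forall l, h l = 1) -> table h i j = 1.
Proof.
move=> eta_neqN1 h1; rewrite /table (negbTE eta_neqN1) !h1.
by case: i; case: j => //=; rewrite scaleE; field; rewrite ?denominators.
Qed.

Lemma gram1 i j : eta != -1 -> gram i j = 1.
Proof.
move=> eta_neqN1; have [a1 b1 g1 p1] := parameters eta_neqN1.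
have ga l : gram_a l = 1 by case: l => //=; rewrite ?a1 ?b1 ?g1 ?p1; field.
have gb l : gram_b l = 1 by case: l => //=; rewrite ?a1 ?b1 ?g1 ?p1; field.
have gc l : gram_c l = 1 by case: l => //=; rewrite ?a1 ?b1 ?g1 ?p1; field.
by case: i => //=; apply: table_one.
Qed.

Lemma gramC i j : gram i j = gram j i.
Proof.
have [eta1|eta1] := eqVneq eta (-1); last by rewrite !gram1.
by case: i; case: j => //=; rewrite /table ?eta1 ?eqxx /= ?scaleE //; field;
  rewrite ?denominators.
Qed.

(** Invariance (g e_i, e_j) = (e_i, g e_j) on basis vectors, each side expanded by linearity. *)
Lemma gram_invariant g i j : is_gen g ->
  table (gram^~ j) g i = table (gram i) g j.
Proof.
have [eta1|eta1] := eqVneq eta (-1); last first.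
  by move=> _; rewrite !table_one // => l; rewrite gram1.
rewrite /gram /table eta1 eqxx.
by case: g => // _; case: i; case: j; rewrite /= ?scaleE; field;
  rewrite ?denominators.
Qed.

Definition letter_pos (l : letter) : nat :=
  match l with
  | Ia => 0 | Ib => 1 | Ic => 2 | Ip => 3
  | Iq => 4 | Ir => 5 | Is => 6 | It => 7
  end.

(** The identity at [g] on basis vectors, seen through a functional with values [x]: the nested
    [table (table x g) i j] is its value on g(e_i e_j). *)
Lemma table_PC_identity g i j (x : letter -> F^o) : is_gen g ->
  table (table x g) i j + table (table x i) g j + table (table x j) g i =
  (1 + eta) *: (table x i j + gram g i *: table x g j + gram g j *: table x g i)
  - eta *: (gram g i *: x j + gram g j *: x i + gram i j *: x g).
Proof.
(* Symmetry in [i] and [j] nearly halves the number of expansions. *)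
wlog le_ij : i j / (letter_pos i <= letter_pos j)%N => [IH gG|].
  have [|/ltnW] := leqP (letter_pos i) (letter_pos j) => le; first exact: IH.
  have := IH j i le gG; rewrite (tableC _ j i) (tableC x j i) (gramC j i) => e.
  by rewrite [LHS]addrAC e scaleE; ring.
have [eta1|eta1] := eqVneq eta (-1).
  rewrite /gram /table eta1 eqxx.
  by case: g => // _; case: i le_ij; case: j => // _;
    rewrite /= ?scaleE; field; rewrite ?denominators.
rewrite !gram1 // /table (negbTE eta1).
by case: g => // _; case: i le_ij; case: j => // _;
  rewrite /= ?scaleE; field; rewrite ?denominators.
Qed.

End Tables.

(** * The universal algebra *)

Section Universal.

Variables (F : fieldType) (V : vectType F) (e : 8.-tuple V).
Hypothesis basis_e : basis_of fullv e.

Definition letter_vec (l : letter) : V := e`_(letter_pos l).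

Definition extend (W : lmodType F) (h : letter -> W) (v : V) : W :=
  \sum_(i < 8) coord e i v *: h (nth Ia letters i).

Lemma extend_linear (W : lmodType F) (h : letter -> W) : linear (extend h).
Proof.
move=> k u v; rewrite scaler_sumr -big_split; apply: eq_bigr => i _ /=.
by rewrite linearP scalerDl scalerA.
Qed.

Lemma extend_linearl (W : lmodType F) (h h' : letter -> W) k v :
  extend (fun l => k *: h l + h' l) v = k *: extend h v + extend h' v.
Proof.
rewrite scaler_sumr -big_split; apply: eq_bigr => i _ /=.
by rewrite scalerDr !scalerA mulrC.
Qed.

Lemma eq_extend (W : lmodType F) (h h' : letter -> W) v :
  h =1 h' -> extend h v = extend h' v.
Proof. by move=> hh'; apply: eq_bigr => i _; rewrite hh'. Qed.

Lemma letter_pos_lt l : (letter_pos l < 8)%N.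
Proof. by case: l. Qed.

Lemma extend_letter (W : lmodType F) (h : letter -> W) l :
  extend h (letter_vec l) = h l.
Proof.
pose i := Ordinal (letter_pos_lt l).
have freeE := basis_free basis_e.
rewrite /extend (bigD1 i) //= (coord_free i i) // eqxx scale1r.
rewrite big1 => [|j ji]; last first.
  by rewrite (coord_free i j) // eq_sym (negbTE ji) scale0r.
by rewrite addr0; case: l {i}.
Qed.

Lemma letter_ind (T : V -> Prop) :
  (forall (k : F) u v, T u -> T v -> T (k *: u + v)) ->
  (forall l, T (letter_vec l)) -> forall v, T v.
Proof.
move=> TD TE v; rewrite (coord_basis basis_e (memvf v)).
have T0 : T 0 by rewrite -(addNr (letter_vec Ia)) -scaleN1r; apply: TD.
elim/big_ind: _ => // [u w Tu Tw|i _].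
  by rewrite -[u]scale1r; apply: TD.
rewrite -[_ *: _]addr0; apply: TD => //.
have -> : e`_i = letter_vec (nth Ia letters i).
  by case: i => -[|[|[|[|[|[|[|[|]]]]]]]].
exact: TE.
Qed.

Lemma eq_functionals (u v : V) :
  (forall g : V -> F^o, linear g -> g u = g v) -> u = v.
Proof.
move=> euv; rewrite (coord_basis basis_e (memvf u)).
rewrite (coord_basis basis_e (memvf v)); apply: eq_bigr => i _; congr (_ *: _).
by apply: euv => k x y; rewrite linearP.
Qed.

(** * The product, the invariant form and the three axes of the universal algebra *)

Variables (eta alpha beta gamma psi : F).
Hypothesis two_neq0 : 2 != 0 :> F.
Hypotheses (eta_neq1 : eta != 1) (eta_neq_half : eta != 2^-1).
Hypothesis parameters :
  eta != -1 -> [/\ alpha = 1, beta = 1, gamma = 1 & psi = 1].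

Let mul := univ_mul e eta alpha beta gamma psi.
Local Notation tab := (table eta alpha beta gamma psi).
Local Notation gr := (gram eta alpha beta gamma psi).

Lemma eq_table (W : lmodType F) (h h' : letter -> W) i j :
  h =1 h' -> tab h i j = tab h' i j.
Proof. by move=> hh'; rewrite /table !hh'. Qed.

Lemma univ_mul_extend u v :
  mul u v = extend (fun i => extend (tab letter_vec i) v) u.
Proof.
apply: eq_bigr => i _; rewrite scaler_sumr; apply: eq_bigr => j _.
by rewrite scalerA.
Qed.

Lemma univ_mul_letter i j :
  mul (letter_vec i) (letter_vec j) = tab letter_vec i j.
Proof. by rewrite univ_mul_extend !extend_letter. Qed.

Lemma univ_comm_algebra : is_comm_algebra mul.
Proof.
have linr u : linear (mul u).
  move=> k v w; rewrite !univ_mul_extend -extend_linearl.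
  by apply: eq_extend => i; rewrite extend_linear.
have mulC : commutative mul.
  move=> u v; rewrite /mul /univ_mul exchange_big /=.
  apply: eq_bigr => j _; apply: eq_bigr => i _; rewrite mulrC; congr (_ *: _).
  exact: (@tableC F eta alpha beta gamma psi V letter_vec).
by split=> // v k u w; rewrite ![mul _ v]mulC linr.
Qed.

Definition univ_form (u v : V) : F^o := extend (fun i => extend (gr i) v) u.

Lemma univ_form_letter i j : univ_form (letter_vec i) (letter_vec j) = gr i j.
Proof. by rewrite /univ_form !extend_letter. Qed.

Lemma univ_form_linear v : scalar (univ_form^~ v).
Proof. by move=> k u w; rewrite /univ_form extend_linear. Qed.

Lemma univ_formC u v : univ_form u v = univ_form v u.
Proof.
rewrite /univ_form /extend; under eq_bigr do rewrite scaler_sumr.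
rewrite exchange_big; apply: eq_bigr => j _; rewrite scaler_sumr.
apply: eq_bigr => i _; rewrite !scalerA mulrC; congr (_ *: _).
exact: gramC.
Qed.

Let mE := algE univ_comm_algebra.
Let BE := formE univ_form_linear univ_formC.

Lemma univ_form_invariant g u v : is_gen g ->
  univ_form (mul (letter_vec g) u) v = univ_form u (mul (letter_vec g) v).
Proof.
move=> gG; move: u; apply: letter_ind => [k u w Tu Tw|i].
  by rewrite !mE !BE Tu Tw.
move: v; apply: letter_ind => [k v w Tv Tw|j].
  by rewrite !mE !BE Tv Tw.
rewrite !univ_mul_letter.
rewrite (@table_linear F eta alpha beta gamma psi V F^o
  (univ_form^~ (letter_vec j))); last exact: univ_form_linear.
rewrite (@table_linear F eta alpha beta gamma psi V F^o
  (univ_form (letter_vec i))); last by move=> k x y; rewrite !BE.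
rewrite (eq_table (h' := gr^~ j)) => [|l];
  last by rewrite /= univ_form_letter.
rewrite [RHS](eq_table (h' := gr i)) => [|l];
  last by rewrite /= univ_form_letter.
exact (gram_invariant two_neq0 parameters i j gG).
Qed.

(** Linearity in both arguments reduces to basis vectors; testing with an arbitrary functional then
    gives [table_PC_identity]. *)
Lemma univ_PC_identity g : is_gen g ->
  PC_identity mul eta univ_form (letter_vec g).
Proof.
move=> gG; pose x := letter_vec g.
apply: letter_ind => [k u u' Tu Tu' v|i].
  rewrite -/x in Tu Tu' *; rewrite !mE !BE.
  apply: (eq_addZ (- k) (Tu v)); apply: (eq_addZ (- 1) (Tu' v)).
  by mod_split F; ring.
apply: letter_ind => [k v v' Tv Tv'|j].
  rewrite -/x in Tv Tv' *; rewrite !mE !BE.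
  apply: (eq_addZ (- k) Tv); apply: (eq_addZ (- 1) Tv').
  by mod_split F; ring.
apply: eq_functionals => f fL.
have f0 : f 0 = 0 by have := fL (-1) 0 0; rewrite scaler0 addr0 scaleN1r addNr.
have fD u v : f (u + v) = f u + f v by have := fL 1 u v; rewrite !scale1r.
have fZ k u : f (k *: u) = k *: f u by have := fL k u 0; rewrite f0 !addr0.
have fN u : f (- u) = - f u by rewrite -scaleN1r fZ scaleN1r.
have f_mul l l' :
    f (mul (letter_vec l) (letter_vec l')) = tab (f \o letter_vec) l l'.
  by rewrite univ_mul_letter [LHS]table_linear.
(* The inner table lists the values of the functional v -> f(e_l v) on the basis. *)
have f_mul2 l l' l'' :
    f (mul (letter_vec l) (mul (letter_vec l') (letter_vec l''))) =
    tab (tab (f \o letter_vec) l) l' l''.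
  rewrite univ_mul_letter.
  rewrite (@table_linear F eta alpha beta gamma psi V F^o
    (fun v => f (mul (letter_vec l) v))); last by move=> k u v; rewrite !mE fL.
  by apply: eq_table => m /=; rewrite f_mul.
rewrite !(fD, fN, fZ) !f_mul2 !f_mul !univ_form_letter.
exact (table_PC_identity two_neq0 parameters i j (f \o letter_vec) gG).
Qed.

Lemma univ_generates :
  generates mul (fun u => [\/ u = e`_0, u = e`_1 | u = e`_2]).
Proof.
move=> S [S0 SD SM] SX; apply: letter_ind => //.
have Sab_c l : is_gen l -> S (letter_vec l).
  by case: l => // _; apply: SX; [apply: Or31 | apply: Or32 | apply: Or33].
have Sm i j l : tab letter_vec i j = letter_vec l ->
    S (letter_vec i) -> S (letter_vec j) -> S (letter_vec l).
  by move=> <- Si Sj; rewrite -univ_mul_letter; apply: SM.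
have Sp : S (letter_vec Ip).
  by apply: (Sm Ia Ib); do ?exact: Sab_c; rewrite // /table; case: ifP.
have Sq : S (letter_vec Iq).
  by apply: (Sm Ib Ic); do ?exact: Sab_c; rewrite // /table; case: ifP.
have Sr : S (letter_vec Ir).
  by apply: (Sm Ia Ic); do ?exact: Sab_c; rewrite // /table; case: ifP.
have Ss : S (letter_vec Is).
  by apply: (Sm Ia Iq); do ?exact: Sab_c; rewrite // /table; case: ifP.
have St : S (letter_vec It).
  by apply: (Sm Ib Ir); do ?exact: Sab_c; rewrite // /table; case: ifP.
by case=> //; apply: Sab_c.
Qed.

Lemma univ_mul_gen g : is_gen g ->
  mul (letter_vec g) (letter_vec g) = letter_vec g.
Proof.
by rewrite univ_mul_letter /table; case: ifP; case: g.
Qed.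

Lemma univ_form_gen g : is_gen g -> univ_form (letter_vec g) (letter_vec g) = 1.
Proof. by rewrite univ_form_letter; case: g. Qed.

Lemma univ_primitive_axis g : is_gen g ->
  is_primitive_axis mul eta (letter_vec g).
Proof.
move=> gG.
apply: (@primitive_axis_of_identity _ _ _ univ_comm_algebra _ univ_form).
all: try by [].
- exact: univ_form_linear.
- exact: univ_formC.
- by move=> u v; apply: univ_form_invariant.
- exact: univ_mul_gen.
- exact: univ_form_gen.
- exact: univ_PC_identity.
Qed.

Lemma univ_axial_gen3 : PC_axial_algebra_gen3 mul eta e`_0 e`_1 e`_2.
Proof.
have axa := @univ_primitive_axis Ia isT.
have axb := @univ_primitive_axis Ib isT.
have axc := @univ_primitive_axis Ic isT.
split=> //; last exact: univ_generates.
split; first exact: univ_comm_algebra.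
exists (fun u => [\/ u = e`_0, u = e`_1 | u = e`_2]).
split; last exact: univ_generates.
by move=> u [] ->; apply: primitive_axis_axis;
  [exact: axa | exact: axb | exact: axc].
Qed.

End Universal.

(** * The universal property *)

Section UniversalProperty.

Variables (F : fieldType) (V : vectType F) (e : 8.-tuple V).
Hypothesis basis_e : basis_of fullv e.
Variables (eta alpha beta gamma psi : F).
Hypothesis two_neq0 : 2 != 0 :> F.
Hypotheses (eta_neq1 : eta != 1) (eta_neq_half : eta != 2^-1).
Hypothesis parameters :
  eta != -1 -> [/\ alpha = 1, beta = 1, gamma = 1 & psi = 1].
Variables (A : lmodType F) (mul : A -> A -> A) (x y z : A).
Variable form : A -> A -> F.
Hypothesis genA : PC_axial_algebra_gen3 mul eta x y z.
Hypothesis frobA : is_Frobenius_form mul form.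
Hypothesis unitA : forall u, is_primitive_axis mul eta u -> form u u = 1.
Hypotheses (xy : form x y = alpha) (yz : form y z = beta).
Hypotheses (xz : form x z = gamma) (xyz : form x (mul y z) = psi).

Local Notation mulV := (univ_mul e eta alpha beta gamma psi).
Local Notation formV := (univ_form e eta alpha beta gamma psi).
Local Notation vec := (letter_vec e).
Local Notation gr := (gram eta alpha beta gamma psi).

Let algA : is_comm_algebra mul := proj1 (gen3_axial genA).
Let mulC := algMC algA.
Let symA := Frobenius_sym frobA.
Let assocA := Frobenius_assoc frobA.
Let BE := formE (Frobenius_linearl frobA) symA.
Let axx := gen3_primitive1 genA.
Let axy := gen3_primitive2 genA.
Let axz := gen3_primitive3 genA.

Let image (l : letter) : A :=
  match l with
  | Ia => x | Ib => y | Ic => z | Ip => mul x y | Iq => mul y z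
  | Ir => mul x z | Is => mul x (mul y z) | It => mul y (mul x z)
  end.

Let f : V -> A := extend e image.

HB.instance Definition _ :=
  GRing.isLinear.Build F V A *:%R f (extend_linear e image).

Let f_letter l : f (vec l) = image l. Proof. exact: extend_letter. Qed.

Lemma identity_gen u : is_primitive_axis mul eta u ->
  PC_identity mul eta form u.
Proof.
move=> axu; apply: PC_identity_of_axis => //.
by apply: (form_rank1 algA two_neq0 eta_neq1 eta_neq_half frobA unitA
  (gen3_generates genA)) => // w [] ->.
Qed.

Let form_square u v w : is_primitive_axis mul eta u ->
  form v (mul u (mul u w)) = (eta + 2^-1) * form v (mul u w)
    - 2^-1 * eta * form v w + 2^-1 * (1 - eta) * form u w * form v u.
Proof.
move=> axu; have [[idu _ _] _ _] := axu.
rewrite (PC_identity_square algA two_neq0 idu (unitA axu) (identity_gen axu)).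
by rewrite !BE.
Qed.

(** For eta = -1 this is direct substitution; otherwise all four values are 1 and so are both
    sides. *)
Let form_correction k l m :
  (eta != -1 -> [/\ k = 1, l = 1 & m = 1]) ->
  forall n, (eta != -1 -> n = 1) ->
  (eta + 2^-1) * k - 2^-1 * eta * l + 2^-1 * (1 - eta) * m * n =
  n * m + (l - k) / 2.
Proof.
move=> klm n n1; have [->|eta_neqN1] := eqVneq eta (-1); first by field.
by have [-> -> ->] := klm eta_neqN1; rewrite n1 //; field.
Qed.

(** Associativity of the form reduces most entries to the four parameters. The four others, such as
    (x, y(xz)) = (y, x(xz)), contain a repeated multiplication by one axis and go through
    [form_square]. *)
Let form_image g l : is_gen g -> form (image g) (image l) = gr g l.
Proof.
have [[idx _ _] _ _] := axx; have [[idy _ _] _ _] := axy.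
have [[idz _ _] _ _] := axz.
have yx : form y x = alpha by rewrite symA.
have zy : form z y = beta by rewrite symA.
have zx : form z x = gamma by rewrite symA.
have yxz : form y (mul x z) = psi by rewrite -assocA (mulC y) assocA.
have zxy : form z (mul x y) = psi by rewrite symA assocA.
case: g => // _; case: l; rewrite /= ?unitA //.
- by rewrite -assocA idx.
- by rewrite -assocA idx.
- by rewrite -assocA idx.
- rewrite -assocA (mulC x) assocA form_square // yxz yz xz yx.
  by rewrite form_correction // => /parameters[].
- by rewrite (mulC x) -assocA idy.
- by rewrite -assocA idy.
- rewrite -assocA (mulC y) assocA form_square // xyz xz yz xy.
  by rewrite form_correction // => /parameters[].
- by rewrite -assocA idy.
- by rewrite (mulC y) -assocA idz.
- by rewrite (mulC x) -assocA idz.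
- rewrite -assocA (mulC z) (mulC y) assocA form_square //.
  rewrite (mulC z) xyz xy zy xz.
  by rewrite form_correction 1?[gamma * _]mulrC // => /parameters[].
- rewrite -assocA symA (mulC z) assocA (mulC y) form_square //.
  rewrite (mulC z) xyz xy zy xz.
  by rewrite form_correction 1?[gamma * _]mulrC // => /parameters[].
Qed.

Lemma universal_homomorphism : homomorphic_image mulV mul.
Proof.
have mulE : forall i j, mulV (vec i) (vec j) =
    table eta alpha beta gamma psi vec i j.
  exact: univ_mul_letter.
have algV := univ_comm_algebra e eta alpha beta gamma psi.
have BV := formE (univ_form_linear e eta alpha beta gamma psi)
  (univ_formC e two_neq0 parameters).
have formf g v : is_gen g -> form (f (vec g)) (f v) = formV (vec g) v.
  move=> gG; move: v; apply: (letter_ind basis_e) => [k u w Tu Tw|l].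
    rewrite /f extend_linear -/f !BE Tu Tw.
    by rewrite !BV.
  by rewrite !f_letter univ_form_letter // form_image.
have gensP g : g \in [:: vec Ia; vec Ib; vec Ic] ->
    exists2 l, is_gen l & g = vec l.
  rewrite !inE => /or3P[] /eqP ->; by [exists Ia | exists Ib | exists Ic].
have letterE i j l : table eta alpha beta gamma psi vec i j = vec l ->
    mulV (vec i) (vec j) = vec l.
  by rewrite mulE.
have pE : mulV (vec Ia) (vec Ib) = vec Ip.
  by apply: letterE; rewrite /table; case: ifP.
have qE : mulV (vec Ib) (vec Ic) = vec Iq.
  by apply: letterE; rewrite /table; case: ifP.
have rE : mulV (vec Ia) (vec Ic) = vec Ir.
  by apply: letterE; rewrite /table; case: ifP.
have sE : mulV (vec Ia) (vec Iq) = vec Is.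
  by apply: letterE; rewrite /table; case: ifP.
have tE : mulV (vec Ib) (vec Ir) = vec It.
  by apply: letterE; rewrite /table; case: ifP.
have idemE g : is_gen g -> mulV (vec g) (vec g) = vec g by exact: univ_mul_gen.
have [[idx _ _] _ _] := axx; have [[idy _ _] _ _] := axy.
have [[idz _ _] _ _] := axz.
have fM_letter i j l : mulV (vec i) (vec j) = vec l ->
    image l = mul (image i) (image j) ->
    f (mulV (vec i) (vec j)) = mul (f (vec i)) (f (vec j)).
  by move=> ->; rewrite !f_letter.
have fM : forall u v, f (mulV u v) = mul (f u) (f v).
  apply: (linear_to_homomorphism (f := f) (a := vec Ia) (b := vec Ib)
    (c := vec Ic) algV algA two_neq0 assocA).
  - move=> g u v /gensP[l lG ->].
    exact: (univ_form_invariant basis_e two_neq0 parameters).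
  - by move=> g /gensP[l lG ->]; apply: idemE.
  - move=> g /gensP[l lG ->].
    exact (univ_form_gen basis_e eta alpha beta gamma psi lG).
  - move=> g /gensP[l lG ->].
    exact (univ_PC_identity basis_e two_neq0 parameters lG).
  - move=> g /gensP[l lG ->]; have axf : is_primitive_axis mul eta (f (vec l)).
      by rewrite f_letter; case: l lG.
    exact (identity_gen axf).
  - by move=> g v /gensP[l lG ->]; apply: formf.
  - rewrite pE qE rE sE tE => T TD Ta Tb Tc Tp Tq Tr Ts Tt.
    by apply: (letter_ind basis_e) => //; case.
  - exact (fM_letter Ia Ia Ia (idemE Ia isT) (esym idx)).
  - exact (fM_letter Ib Ib Ib (idemE Ib isT) (esym idy)).
  - exact (fM_letter Ic Ic Ic (idemE Ic isT) (esym idz)).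
  - exact (fM_letter Ia Ib Ip pE erefl).
  - exact (fM_letter Ib Ic Iq qE erefl).
  - exact (fM_letter Ia Ic Ir rE erefl).
  - by rewrite qE; exact (fM_letter Ia Iq Is sE erefl).
  - by rewrite rE; exact (fM_letter Ib Ir It tE erefl).
exists f; split=> // w.
(* Surjectivity: the range of [f] is a subalgebra containing the three generators. *)
apply: (gen3_generates genA (S := fun w => exists u, f u = w)) => [|u [] ->].
- split=> [|k _ _ [u <-] [v <-]|_ _ [u <-] [v <-]].
  + by exists 0; apply: linear0.
  + by exists (k *: u + v); apply: linearP.
  + by exists (mulV u v).
- by exists (vec Ia); exact (f_letter Ia).
- by exists (vec Ib); exact (f_letter Ib).
- by exists (vec Ic); exact (f_letter Ic).
Qed.

End UniversalProperty.

Theorem corollary5 (F : fieldType) (eta alpha beta gamma psi : F)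
    (V : vectType F) (e : 8.-tuple V) :
  2%N \notin [pchar F] -> 3%N \notin [pchar F] ->
  eta != 1 -> eta != 2^-1 ->
  (eta != -1 -> [/\ alpha = 1, beta = 1, gamma = 1 & psi = 1]) ->
  basis_of fullv e ->
  PC_axial_algebra_gen3 (univ_mul e eta alpha beta gamma psi) eta
    e`_0 e`_1 e`_2 /\
  forall (A : lmodType F) (mul : A -> A -> A) (x y z : A) (form : A -> A -> F),
    PC_axial_algebra_gen3 mul eta x y z ->
    is_Frobenius_form mul form ->
    (forall u, is_primitive_axis mul eta u -> form u u = 1) ->
    form x y = alpha -> form y z = beta -> form x z = gamma ->
    form x (mul y z) = psi ->
    homomorphic_image (univ_mul e eta alpha beta gamma psi) mul.
Proof.
move=> two_neq0 _ eta1 eta2 parameters basis_e.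
have {}two_neq0 : 2 != 0 :> F by move: two_neq0; rewrite inE.
split; first exact: univ_axial_gen3.
move=> A mul x y z form genA frobA unitA xy yz xz xyz.
exact: (universal_homomorphism basis_e two_neq0 eta1 eta2 parameters genA frobA
  unitA xy yz xz xyz).
Qed.
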